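(* There exists an absolute constant $C>0$ such that the following holds. Let $d\geq n$ and let $X\in\mathbb{R}^{n\times d}$ be a random matrix whose rows $\mathbf{x}_1^\top,\ldots,\mathbf{x}_n^\top$ are i.i.d. random vectors. Let $\Sigma:=\mathbb{E}\left[\frac{1}{n}X^\top X\right]\in\mathbb{R}^{d\times d}$, assume that $\Sigma$ is invertible, and let $\hat{\Sigma}:=\frac{1}{n}X^\top X$. Assume further that the $\mathbf{x}_i$ are mean-zero, and that the entries $z_{ij}$ ($i\in[n]$, $j\in[d]$) of the vectors $\mathbf{z}_i:=\Sigma^{-1/2}\mathbf{x}_i$ are independent sub-gaussian random variables with variance $1$ and sub-gaussian norm $\|z_{ij}\|_{\psi_2}\leq K$ for all $i\in[n]$, $j\in[d]$. Then for any $t\geq 0$, with probability at least $1-2\exp(-t^2)$ it holds that for all $i\in[n]$, $$\lambda_{i+d-n}(\Sigma)\left(1 - CK^2\max(\epsilon, \epsilon^2)\right) \leq \frac{n}{d}\, \lambda_i(\hat\Sigma) \leq \lambda_i(\Sigma)\left(1 + CK^2\max(\epsilon, \epsilon^2)\right),$$ where $\epsilon:=\sqrt{\frac{n}{d}}+\frac{t}{\sqrt{d}}$.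
   Context: $\lambda_i(\cdot)$ denotes the $i$-th largest eigenvalue of a symmetric matrix ($\lambda_1\geq\lambda_2\geq\dots$), and $[k]=\{1,\ldots,k\}$. A real random variable $z$ is sub-gaussian if $\|z\|_{\psi_2}:=\sup_{p\geq 1}\frac{1}{\sqrt{p}}\left(\mathbb{E}[|z|^p]\right)^{1/p}<\infty$. *)

(* Defs.v *)
From HB Require Import structures.
From mathcomp Require Import all_boot all_order all_algebra.
From mathcomp Require Import polyrcf complex.
From mathcomp Require Import all_classical all_reals all_analysis.
Set Implicit Arguments.
Unset Strict Implicit.
Unset Printing Implicit Defensive.
Import Order.TTheory GRing.Theory Num.Theory.
Local Open Scope classical_set_scope.
Local Open Scope ring_scope.

(* Real eigenvalues of A, with algebraic multiplicity, in decreasing order;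
   for symmetric A these are all n eigenvalues, see char_poly_eigenvals. *)
Definition eigenvals (R : rcfType) (n : nat) (A : 'M[R]_n) : seq R :=
  sort >=%R
    (flatten [seq nseq (mup a (char_poly A)) a | a <- rootsR (char_poly A)]).

(* Indices start at 1: lambda 1 A is the largest eigenvalue. *)
Definition lambda (R : rcfType) (n : nat) (i : nat) (A : 'M[R]_n) : R :=
  (eigenvals A)`_i.-1.

Lemma sym_char_poly_split (R : rcfType) (n : nat) (A : 'M[R]_n) :
  A^T = A -> exists s : seq R, char_poly A = \prod_(a <- s) ('X - a%:P).
Proof.
move=> symA; pose f := real_complex R : {rmorphism R -> R[i]}.
pose B := map_mx f A.
have symB : B^T = B by rewrite /B map_trmx symA.
have conjB : map_mx Num.conj B = B.
  by apply/matrixP => i j; rewrite !mxE conj_Creal // complex_real.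
have realB z : root (char_poly B) z -> z \is Num.real.
  rewrite -eigenvalue_root_char => /eigenvalueP[v vB v0].
  pose u := map_mx Num.conj v.
  pose N := (v *m u^T) 0 0.
  have NE : N = \sum_j `|v 0 j| ^+ 2.
    by rewrite /N mxE; apply: eq_bigr => j _; rewrite !mxE normCK.
  have N0 : N != 0.
    apply: contraNneq v0 => N0; apply/eqP/rowP => j; rewrite mxE.
    move/eqP: N0; rewrite NE psumr_eq0 => [|k _]; last by rewrite exprn_ge0.
    by move=> /allP/(_ j (mem_index_enum _)); rewrite sqrf_eq0 normr_eq0 => /eqP.
  have uK : map_mx Num.conj u = v.
    by apply/matrixP => i j; rewrite !mxE conjCK.
  have Nr : N^* = N.
    by apply: conj_Creal; rewrite NE; apply: rpred_sum => j _; rewrite realX ?normr_real.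
  have cE : (v *m B *m u^T) 0 0 = z * N by rewrite vB -scalemxAl mxE.
  have cR : ((v *m B *m u^T) 0 0)^* = (v *m B *m u^T) 0 0.
    have -> : ((v *m B *m u^T) 0 0)^* = (map_mx Num.conj (v *m B *m u^T)) 0 0.
      by rewrite [RHS]mxE.
    rewrite !map_mxM /= conjB -/u -map_trmx uK.
    have -> : u *m B *m v^T = (v *m B *m u^T)^T.
      by rewrite !trmx_mul trmxK symB mulmxA.
    by rewrite mxE.
  apply/CrealP; apply: (mulIf N0).
  have -> : z^* * N = (z * N)^* by rewrite rmorphM /= Nr.
  by rewrite -cE cR.
have [s sE] := closed_field_poly_normal (char_poly B).
rewrite (monicP (char_poly_monic B)) scale1r in sE.
exists [seq complex.Re z | z <- s]; apply: (map_poly_inj f).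
rewrite map_char_poly -/B sE rmorph_prod big_map /=.
apply: eq_big_seq => z zs; rewrite rmorphB /= map_polyX map_polyC /=.
by rewrite RRe_real // realB // sE root_prod_XsubC.
Qed.

Lemma eigenvals_sorted (R : rcfType) (n : nat) (A : 'M[R]_n) :
  sorted >=%R (eigenvals A).
Proof. by apply: sort_sorted => x y; apply: le_total. Qed.

Lemma char_poly_eigenvals (R : rcfType) (n : nat) (A : 'M[R]_n) :
  A^T = A -> char_poly A = \prod_(a <- eigenvals A) ('X - a%:P).
Proof.
move=> /sym_char_poly_split[s sE]; rewrite sE; apply: perm_big.
rewrite perm_sym /eigenvals perm_sort.
rewrite -(permPr (perm_count_undup s)).
have p0 : char_poly A != 0 by rewrite monic_neq0 ?char_poly_monic.
have -> : [seq nseq (mup a (char_poly A)) a | a <- rootsR (char_poly A)] =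
          [seq nseq (count_mem a s) a | a <- rootsR (char_poly A)].
  by apply: eq_map => a; rewrite sE mu_prod_XsubC.
apply/perm_flatten/perm_map/uniq_perm; rewrite ?undup_uniq ?uniq_roots //.
move=> a; rewrite mem_undup -(root_prod_XsubC s) -sE.
by have := roots_on_rootsR p0 a; rewrite itv_boundlr /= => ->.
Qed.

Lemma size_eigenvals (R : rcfType) (n : nat) (A : 'M[R]_n) :
  A^T = A -> size (eigenvals A) = n.
Proof.
move=> /char_poly_eigenvals/(congr1 (fun p : {poly R} => size p)).
by rewrite size_char_poly size_prod_XsubC => -[].
Qed.

Definition psdmx (R : rcfType) (n : nat) (A : 'M[R]_n) : Prop :=
  A^T = A /\ forall v : 'cV[R]_n, 0 <= (v^T *m A *m v) 0 0.

Lemma normsq_ge0 (R : rcfType) (m : nat) (v : 'cV[R]_m) :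
  0 <= (v^T *m v) 0 0.
Proof. by rewrite mxE sumr_ge0 // => j _; rewrite mxE -expr2 sqr_ge0. Qed.

Lemma normsq_eq0 (R : rcfType) (m : nat) (v : 'cV[R]_m) :
  (v^T *m v) 0 0 = 0 -> v = 0.
Proof.
rewrite mxE => /eqP; rewrite psumr_eq0 => [|j _]; last first.
  by rewrite mxE -expr2 sqr_ge0.
move=> /allP v0; apply/colP => j; rewrite mxE.
have := v0 j (mem_index_enum _); rewrite mxE mulf_eq0.
by case/orP => /eqP.
Qed.

Lemma sym_sqr_eq0 (R : rcfType) (n : nat) (N : 'M[R]_n) :
  N^T = N -> N *m N = 0 -> N = 0.
Proof.
move=> symN NN; apply/matrixP => i j.
have : col j N = 0.
  apply: normsq_eq0.
  by rewrite colE trmx_mul symN mulmxA -(mulmxA _ N N) NN mulmx0 mul0mx mxE.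
by move=> /colP/(_ i); rewrite !mxE.
Qed.

Lemma horner_mx_sym (R : rcfType) (n : nat) (A : 'M[R]_n.+1) (p : {poly R}) :
  A^T = A -> (horner_mx A p)^T = horner_mx A p.
Proof.
move=> symA; elim/poly_ind: p => [|p c IHp]; first by rewrite rmorph0 trmx0.
rewrite rmorphD rmorphM /= horner_mx_X horner_mx_C raddfD /= tr_scalar_mx.
congr (_ + _); rewrite trmx_mul IHp symA.
exact: (comm_mx_horner p (erefl : comm_mx A A)).
Qed.

Lemma poly_interp (R : fieldType) (s : seq R) (f : R -> R) :
  exists p : {poly R}, {in s, forall a, p.[a] = f a}.
Proof.
elim: s => [|a s [p pE]]; first by exists 0.
have [as_|aNs] := boolP (a \in s).
  by exists p => b; rewrite inE => /predU1P[->|]; apply: pE.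
pose q := \prod_(b <- s) ('X - b%:P).
have qa : q.[a] != 0 by rewrite -rootE root_prod_XsubC.
exists (p + ((f a - p.[a]) / q.[a]) *: q) => b; rewrite inE => /predU1P[->|bs].
  by rewrite !hornerE divfK // addrC subrK.
have /rootP qb : root q b by rewrite root_prod_XsubC.
by rewrite !hornerE qb mulr0 addr0 pE.
Qed.

Lemma horner_mx_eq0 (R : rcfType) (n : nat) (A : 'M[R]_n.+1) (p : {poly R}) :
  A^T = A -> (forall a, root (char_poly A) a -> p.[a] = 0) ->
  horner_mx A p = 0.
Proof.
move=> symA p0; have [s sE] := sym_char_poly_split symA.
have dvd : char_poly A %| p ^+ size s.
  have : {in s, forall a, p.[a] = 0}.
    by move=> a as_; apply: p0; rewrite sE root_prod_XsubC.
  rewrite sE; elim: (s) => [|a t IHt] pt; first by rewrite big_nil dvd1p.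
  rewrite big_cons /= exprS dvdp_mul //.
    by rewrite dvdp_XsubCl rootE pt ?mem_head.
  by apply: IHt => b bt; rewrite pt // inE bt orbT.
have [q qE] : exists q, p ^+ size s = q * char_poly A by apply/dvdpP.
set N := horner_mx A p.
have symN : N^T = N by apply: horner_mx_sym.
have N0 : N ^+ (2 ^ size s) = 0.
  rewrite -(subnK (ltnW (ltn_expl (size s) (ltnSn 1)))) exprD.
  have -> : N ^+ size s = 0.
    by rewrite -rmorphXn qE rmorphM /= Cayley_Hamilton mulr0.
  by rewrite mulr0.
elim: (size s) N0 => [|k IHk]; first by rewrite expr1.
rewrite expnSr exprM expr2 => N0; apply: IHk; apply: sym_sqr_eq0 => //.
by rewrite -rmorphXn horner_mx_sym.
Qed.

Lemma psdmx_root_ge0 (R : rcfType) (n : nat) (A : 'M[R]_n) (a : R) :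
  psdmx A -> root (char_poly A) a -> 0 <= a.
Proof.
move=> [symA psdA]; rewrite -eigenvalue_root_char => /eigenvalueP[v vA v0].
have := psdA v^T; rewrite trmxK vA -scalemxAl mxE.
rewrite pmulr_lge0 // lt_neqAle; apply/andP; split; last first.
  by have := normsq_ge0 v^T; rewrite trmxK.
apply: contraNneq v0 => /esym; rewrite -{1}[v]trmxK => /normsq_eq0 v0.
by rewrite -[v]trmxK v0 trmx0.
Qed.

Lemma psdmx_sqr (R : rcfType) (n : nat) (T : 'M[R]_n) :
  T^T = T -> psdmx (T *m T).
Proof.
move=> symT; split=> [|v]; first by rewrite trmx_mul symT.
have -> : v^T *m (T *m T) *m v = (T *m v)^T *m (T *m v).
  by rewrite trmx_mul symT !mulmxA.
exact: normsq_ge0.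
Qed.

(* p = sqrt and q = fourth root on the spectrum, so that p(A) = q(A)^2 *)
Lemma psdmx_sqrt_poly (R : rcfType) (n : nat) (A : 'M[R]_n.+1) : psdmx A ->
  exists p, psdmx (horner_mx A p) /\ horner_mx A p *m horner_mx A p = A.
Proof.
move=> psdA; have [symA _] := psdA; have [s sE] := sym_char_poly_split symA.
have [p pE] := poly_interp s Num.sqrt.
have [q qE] := poly_interp s (fun a => Num.sqrt (Num.sqrt a)).
have in_s a : root (char_poly A) a -> a \in s by rewrite sE root_prod_XsubC.
have sqr f g : (forall a, root (char_poly A) a -> f.[a] ^+ 2 = g.[a]) ->
    horner_mx A f *m horner_mx A f = horner_mx A g.
  move=> fg; apply/eqP; rewrite -subr_eq0 -[_ *m _]/(_ * _) -rmorphM -rmorphB.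
  apply/eqP/horner_mx_eq0 => // a /fg fga.
  by rewrite !hornerE -fga subrr.
exists p; split.
  rewrite -(sqr q) => [|a /in_s sa]; last first.
    by rewrite qE // pE // sqr_sqrtr ?sqrtr_ge0.
  by apply/psdmx_sqr/horner_mx_sym.
rewrite (sqr p 'X) ?horner_mx_X // => a ra.
by rewrite pE ?in_s // hornerX sqr_sqrtr // (psdmx_root_ge0 psdA).
Qed.

Lemma psdmx_sqrt_exists (R : rcfType) (n : nat) (A : 'M[R]_n) : psdmx A ->
  exists S, psdmx S /\ S *m S = A.
Proof.
case: n A => [|n] A psdA; first by exists A; split=> //; apply/matrixP => -[].
by have [p ?] := psdmx_sqrt_poly psdA; exists (horner_mx A p).
Qed.

Lemma psdmx_ker (R : rcfType) (n : nat) (A : 'M[R]_n) (v : 'cV[R]_n) :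
  psdmx A -> (v^T *m A *m v) 0 0 = 0 -> A *m v = 0.
Proof.
move=> /psdmx_sqrt_exists[S [[symS _] <-]] vAv.
have : (S *m v)^T *m (S *m v) = v^T *m (S *m S) *m v.
  by rewrite trmx_mul symS !mulmxA.
by move=> /matrixP/(_ 0 0); rewrite vAv -mulmxA => /normsq_eq0 ->; rewrite mulmx0.
Qed.

Lemma psdmx_sqrt_unique (R : rcfType) (n : nat) (S1 S2 : 'M[R]_n) :
  psdmx S1 -> psdmx S2 -> S1 *m S1 = S2 *m S2 -> S1 = S2.
Proof.
case: n S1 S2 => [|n] S1 S2; first by move=> *; apply/matrixP => -[].
suff aux (A S : 'M[R]_n.+1) p : psdmx (horner_mx A p) ->
    horner_mx A p *m horner_mx A p = A -> psdmx S -> S *m S = A ->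
    S = horner_mx A p.
  move=> psd1 psd2 S12.
  have [p [psdp pE]] := psdmx_sqrt_poly (psdmx_sqr (proj1 psd1)).
  by rewrite (aux _ _ p psdp pE psd1 erefl) (aux _ _ p psdp pE psd2).
move=> psdp pE psdS SE; set B := horner_mx A p in psdp pE *.
have SB : comm_mx S B.
  by apply: comm_mx_horner; rewrite /comm_mx -SE mulmxA.
have symB := proj1 psdp; have symS := proj1 psdS.
pose W := B - S; have symW : W^T = W by rewrite linearB /= symB symS.
have WBS : W *m (B + S) = 0.
  by rewrite mulmxDr !mulmxBl pE SE SB addrA subrK subrr.
have W0 (v : 'cV[R]_n.+1) : B *m (W *m v) = 0 /\ S *m (W *m v) = 0.
  have : (W *m v)^T *m B *m (W *m v) + (W *m v)^T *m S *m (W *m v) = 0.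
    rewrite -mulmxDl -mulmxDr trmx_mul symW -(mulmxA v^T) WBS.
    by rewrite mulmx0 mul0mx.
  move=> /matrixP/(_ 0 0); rewrite mxE [RHS]mxE => /eqP.
  rewrite paddr_eq0 ?(proj2 psdp) ?(proj2 psdS) // => /andP[/eqP h1 /eqP h2].
  by split; apply: psdmx_ker.
have WW : W *m W = 0.
  apply/matrixP => i j; have [BW SW] := W0 (delta_mx j 0).
  have : col j (W *m W) = 0 by rewrite colE -mulmxA mulmxBl BW SW subrr.
  by move=> /colP/(_ i); rewrite !mxE.
by apply/esym/eqP; rewrite -subr_eq0; apply/eqP/sym_sqr_eq0.
Qed.

(* The positive semidefinite square root; 0 if A is not positive
   semidefinite. *)
Definition sqrtmx (R : rcfType) (n : nat) (A : 'M[R]_n) : 'M[R]_n :=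
  xget 0 [set S | psdmx S /\ S *m S = A].

Lemma sqrtmxP (R : rcfType) (n : nat) (A : 'M[R]_n) : psdmx A ->
  psdmx (sqrtmx A) /\ sqrtmx A *m sqrtmx A = A.
Proof.
by move=> /psdmx_sqrt_exists; exact: (@xgetPex _ 0 [set S | psdmx S /\ S *m S = A]).
Qed.

Lemma sqrtmx_eq (R : rcfType) (n : nat) (A S : 'M[R]_n) :
  psdmx S -> S *m S = A -> sqrtmx A = S.
Proof.
move=> psdS SA; apply: xget_unique => [//|S' [psdS' S'A]].
by apply: psdmx_sqrt_unique; rewrite ?SA.
Qed.

Definition mutually_independent (disp : measure_display)
    (T : measurableType disp) (R : realType) (P : probability T R)
    (I : finType) (disp' : measure_display) (U : measurableType disp')
    (Y : I -> T -> U) : Prop :=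
  forall (J : {set I}) (B : I -> set U), (forall i, measurable (B i)) ->
    P (\bigcap_(i in [set` J]) (Y i @^-1` B i)) =
    (\prod_(i in J) P (Y i @^-1` B i))%E.

Definition identically_distributed (disp : measure_display)
    (T : measurableType disp) (R : realType) (P : probability T R)
    (I : Type) (disp' : measure_display) (U : measurableType disp')
    (Y : I -> {RV P >-> U}) : Prop :=
  forall (i j : I) (B : set U), measurable B ->
    distribution P (Y i) B = distribution P (Y j) B.

(* 'N[P]_(p%:E)[EFin \o z] is (E|z|^p)^(1/p); the supremum is over real p >= 1. *)
Definition psi2_norm (disp : measure_display) (T : measurableType disp)
    (R : realType) (P : probability T R) (z : T -> R) : \bar R :=
  ereal_sup [set ((Num.sqrt p)^-1%:E * 'N[P]_(p%:E)[EFin \o z])%E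
            | p in [set p : R | 1 <= p]].

Definition sub_gaussian (disp : measure_display) (T : measurableType disp)
    (R : realType) (P : probability T R) (z : T -> R) : Prop :=
  (psi2_norm P z < +oo)%E.

Section RandomMatrix.
Context (disp : measure_display) (T : measurableType disp) (R : realType).
Context (P : probability T R) (n d : nat) (x : 'I_n -> {RV P >-> d.-tuple R}).

(* The random matrix with rows x i. *)
Definition rowsmx (w : T) : 'M[R]_(n, d) := \matrix_(i, j) tnth (x i w) j.

Definition sample_cov (w : T) : 'M[R]_d :=
  n%:R^-1 *: ((rowsmx w)^T *m rowsmx w).

(* Entrywise expectation of sample_cov. *)
Definition covmx : 'M[R]_d :=
  \matrix_(j, k) fine 'E_P[fun w => sample_cov w j k].

(* covmx^(-1/2) applied to the i-th row, seen as a column vector. *)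
Definition whitened (i : 'I_n) (w : T) : 'cV[R]_d :=
  invmx (sqrtmx covmx) *m (row i (rowsmx w))^T.

End RandomMatrix.

(* Main.v *)
Require Import Defs.
From HB Require Import structures.
From mathcomp Require Import all_boot all_order all_algebra.
From mathcomp Require Import all_classical all_reals all_analysis.
From mathcomp Require Import measurable_realfun zify ring lra.
Set Implicit Arguments.
Unset Strict Implicit.
Unset Printing Implicit Defensive.
Import Order.TTheory GRing.Theory Num.Theory.
Local Open Scope classical_set_scope.
Local Open Scope ring_scope.

(* Write X = Z S with S = Sigma^(1/2), so that n Sigma_hat = S Z^T Z S. If
   |(1/d) |v Z|^2 - |v|^2| <= delta |v|^2 for all v, then
   S Z^T Z S <= d (1 + delta) Sigma, which gives the upper bounds, and the
   min-max principle on the preimage of the row space of Z gives the lower ones.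
   The quadratic form |v Z|^2 - d |v|^2 = sum_j (<v, Z_j>^2 - |v|^2) is controlled
   on a net of exp (O (n)) points of the unit ball by a Bernstein-type bound: the
   columns Z_j are independent and <v, Z_j> is sub-gaussian with second moment
   |v|^2. Since d eps^2 >= n + t^2, a union bound over the net concludes. *)

(** * Spectral theorem and min-max bounds for [lambda] *)

(** The square of a sub-gaussian variable is only sub-exponential: the Laplace transform of <v,
    Z_j>^2 - |v|^2 is controlled only for parameters up to a multiple of 1/K^2. This is the source
    of max(eps, eps^2): with a parameter proportional to min(1, eps)/K^2 the gain is of order d
    min(1, eps) max(eps, eps^2) = d eps^2, whether eps is below or above 1, while the quadratic
    loss, of order d min(1, eps)^2, never exceeds that order. Sub-gaussianity is carried as E exp(a
    z^2) <= 2, the form needed for centred squares, but independence inside a column acts on E exp(s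
    z). Each column therefore makes a round trip, to E exp(s z) and back through the moments, which
    replaces [a] by a/32 whatever n is. These bounds need |v| <= 1, hence a net that stays inside
    the ball. Independence is given for events attached to single entries only; a pi-system argument
    and Tonelli turn it into factorisation of expectations over blocks of entries. *)

Section spectral.
Variable R : rcfType.

Definition rdot n (u v : 'rV[R]_n) : R := (u *m v^T) 0 0.
Definition quad n (A : 'M[R]_n) (u : 'rV[R]_n) : R := (u *m A *m u^T) 0 0.

Lemma rdotE n (u v : 'rV[R]_n) : rdot u v = \sum_j u 0 j * v 0 j.
Proof. by rewrite /rdot mxE; apply: eq_bigr => j _; rewrite mxE. Qed.

Lemma rdot_sqr n (u : 'rV[R]_n) : rdot u u = \sum_j u 0 j ^+ 2.
Proof. by rewrite rdotE; apply: eq_bigr => j _; rewrite expr2. Qed.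

Lemma rdotC n (u v : 'rV[R]_n) : rdot u v = rdot v u.
Proof. by rewrite !rdotE; apply: eq_bigr => j _; rewrite mulrC. Qed.

Lemma rdot_ge0 n (u : 'rV[R]_n) : 0 <= rdot u u.
Proof. by rewrite rdot_sqr sumr_ge0 // => j _; rewrite sqr_ge0. Qed.

Lemma rdot_eq0 n (u : 'rV[R]_n) : (rdot u u == 0) = (u == 0).
Proof.
apply/idP/eqP => [/eqP u0|->]; last by rewrite /rdot mul0mx mxE.
by rewrite -[u]trmxK (@normsq_eq0 _ _ u^T) ?trmx0// trmxK.
Qed.

Lemma rdot_gt0 n (u : 'rV[R]_n) : u != 0 -> 0 < rdot u u.
Proof. by move=> u0; rewrite lt_neqAle rdot_ge0 eq_sym rdot_eq0 u0. Qed.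

Lemma rdotBl n (u v w : 'rV[R]_n) : rdot (u - v) w = rdot u w - rdot v w.
Proof. by rewrite /rdot mulmxBl mxE [X in _ + X]mxE. Qed.

Lemma rdotBr n (u v w : 'rV[R]_n) : rdot w (u - v) = rdot w u - rdot w v.
Proof. by rewrite ![rdot w _]rdotC rdotBl. Qed.

Lemma rdotDl n (u v w : 'rV[R]_n) : rdot (u + v) w = rdot u w + rdot v w.
Proof. by rewrite /rdot mulmxDl mxE. Qed.

Lemma rdotDr n (u v w : 'rV[R]_n) : rdot w (u + v) = rdot w u + rdot w v.
Proof. by rewrite ![rdot w _]rdotC rdotDl. Qed.

Lemma sym_root n (A : 'M[R]_n.+1) : A^T = A -> exists a, root (char_poly A) a.
Proof.
move=> /sym_char_poly_split[[|a s] sE]; last first.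
  by exists a; rewrite sE root_prod_XsubC mem_head.
by have := size_char_poly A; rewrite sE big_nil size_poly1.
Qed.

Lemma sym_unit_eigenvector n (A : 'M[R]_n.+1) : A^T = A ->
  exists a (v : 'rV[R]_n.+1), v *m A = a *: v /\ v *m v^T = 1%:M.
Proof.
move=> /sym_root[a]; rewrite -eigenvalue_root_char => /eigenvalueP[v vA v0].
have dv := rdot_gt0 v0.
exists a, ((Num.sqrt (rdot v v))^-1 *: v); split.
  by rewrite -scalemxAl vA !scalerA mulrC.
apply/matrixP => i j; rewrite !ord1 linearZ /= -scalemxAl -scalemxAr scalerA.
rewrite mxE -/(rdot v v) mxE eqxx -invfM -expr2 sqr_sqrtr ?ltW// mulVf//.
by rewrite gt_eqF.
Qed.

(** The reflection in the hyperplane orthogonal to [w], the identity if [w] is 0. It completes a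
    unit vector to an orthonormal basis without Gram-Schmidt. *)
Definition householder n (w : 'rV[R]_n) : 'M[R]_n :=
  1%:M - (2 / rdot w w) *: (w^T *m w).

Lemma mx11_rdot n (u v : 'rV[R]_n) : u *m v^T = (rdot u v)%:M.
Proof. exact: mx11_scalar. Qed.

Lemma householder_sym n (w : 'rV[R]_n) : (householder w)^T = householder w.
Proof. by rewrite /householder linearB linearZ /= trmx1 trmx_mul trmxK. Qed.

Lemma mul_householder n (u w : 'rV[R]_n) :
  u *m householder w = u - (2 / rdot w w * rdot u w) *: w.
Proof.
rewrite mulmxBr mulmx1 -scalemxAr mulmxA mx11_rdot mul_scalar_mx scalerA.
by [].
Qed.

Lemma householderK n (w : 'rV[R]_n) : householder w *m householder w = 1%:M.
Proof.
have wH : w *m householder w = - w.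
  rewrite mul_householder; have [->|w0] := eqVneq w 0.
    by rewrite scaler0 subr0 oppr0.
  by rewrite divfK ?rdot_eq0// scaler_nat mulr2n opprD addNKr.
rewrite {1}/householder mulmxBl mul1mx -scalemxAl -mulmxA wH mulmxN scalerN.
by rewrite opprK /householder subrK.
Qed.

(** For vectors of equal length the mirror orthogonal to v - u bisects them: <u, v - u> = - |v -
    u|^2 / 2, so the reflection adds exactly v - u to [u]. *)
Lemma householder_map n (u v : 'rV[R]_n) :
  rdot u u = 1 -> rdot v v = 1 -> u *m householder (v - u) = v.
Proof.
move=> u1 v1; rewrite mul_householder.
have [vu|vu] := eqVneq (v - u) 0.
  by rewrite vu scaler0 subr0; apply/esym/eqP; rewrite -subr_eq0 vu.
have E : rdot (v - u) (v - u) = 2 - 2 * rdot u v.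
  by rewrite rdotBl !rdotBr u1 v1 (rdotC v u); ring.
have -> : rdot u (v - u) = - (rdot (v - u) (v - u) / 2).
  by rewrite E rdotBr u1; field.
have nz : rdot (v - u) (v - u) != 0 by rewrite rdot_eq0.
have -> : 2 / rdot (v - u) (v - u) * - (rdot (v - u) (v - u) / 2) = -1.
  by field.
by rewrite scaleN1r opprK subrKC.
Qed.

(** Deflation: a reflection H takes e0 to a unit eigenvector, so e0 is an eigenvector of H A H.
    Symmetry then clears both off-diagonal blocks, and the induction hypothesis diagonalises the
    remaining one. The rows of [P] are the eigenvectors. *)
Lemma sym_spectral n (A : 'M[R]_n) : A^T = A ->
  exists (P : 'M[R]_n) (e : 'rV[R]_n),
    P *m P^T = 1%:M /\ P *m A *m P^T = diag_mx e.
Proof.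
elim: n A => [|n IHn] A symA.
  by exists 1%:M, 0; split; apply/matrixP => -[].
have [a [v [vA v1]]] := sym_unit_eigenvector symA.
pose e0 : 'rV[R]_n.+1 := delta_mx 0 0.
pose H := householder (v - e0).
have HH : H *m H = 1%:M by exact: householderK.
have HT : H^T = H by exact: householder_sym.
have e0H : e0 *m H = v.
  apply: householder_map; last by rewrite /rdot v1 mxE eqxx.
  by rewrite rdot_sqr (bigD1 0)//= big1 ?mxE ?eqxx ?expr1n ?addr0// => j j0;
    rewrite mxE eqxx (negPf j0) expr0n.
(* A mere retyping of H A H, whose size must read 1 + n for the block operations. *)
have [B BE] : exists B : 'M[R]_(1 + n), B = H *m A *m H by exists (H *m A *m H).
have symB : B^T = B by rewrite BE !trmx_mul HT symA mulmxA.
have e0B : e0 *m B = a *: e0.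
  rewrite BE !mulmxA e0H vA -scalemxAl -[in LHS]e0H -mulmxA HH mulmx1 //.
have rB : row 0 B = a *: e0 by rewrite rowE.
have Bur : ursubmx B = 0.
  apply/rowP => j; rewrite !mxE.
  have /rowP/(_ (rshift 1 j)) := rB; rewrite !mxE/= mulr0 => <-.
  by congr (B _ _); apply/val_inj.
have Bul : ulsubmx B = a%:M.
  apply/matrixP => i j; rewrite !ord1 !mxE.
  have /rowP/(_ 0) := rB; rewrite !mxE/= mulr1 => <-.
  by congr (B _ _); apply/val_inj.
have Bdl : dlsubmx B = 0.
  by rewrite -[B]symB -trmx_ursub Bur trmx0.
have symBdr : (drsubmx B)^T = drsubmx B by rewrite trmx_drsub symB.
have [P' [e' [PP' PBP']]] := IHn _ symBdr.
pose Q : 'M[R]_(1 + n) := block_mx 1%:M 0 0 P'.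
have QT : Q^T = block_mx 1%:M 0 0 P'^T by rewrite tr_block_mx !trmx0 trmx1.
have QQ : Q *m Q^T = 1%:M.
  rewrite QT mulmx_block !mul0mx !mulmx0 mul1mx !addr0 add0r PP'.
  by rewrite -scalar_mx_block.
have QBQ : Q *m B *m Q^T = diag_mx (row_mx a%:M e').
  rewrite QT -[B]submxK Bur Bul Bdl !mulmx_block.
  rewrite !(mul0mx, mulmx0, mul1mx, mulmx1, addr0, add0r) PBP' diag_mx_row.
  by congr block_mx; apply/matrixP => i j; rewrite !ord1 !mxE.
exists (Q *m H), (row_mx a%:M e'); split.
  by rewrite trmx_mul HT mulmxA -(mulmxA Q) HH mulmx1.
by rewrite trmx_mul HT !mulmxA -(mulmxA Q) -(mulmxA Q) -BE.
Qed.

Lemma perm_prod_XsubC (s t : seq R) :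
  \prod_(a <- s) ('X - a%:P) = \prod_(a <- t) ('X - a%:P) -> perm_eq s t.
Proof.
by move=> st; apply/allP => a _ /=; rewrite -!mu_prod_XsubC st.
Qed.

Lemma char_poly_conj n (A P : 'M[R]_n) : P *m P^T = 1%:M ->
  char_poly (P *m A *m P^T) = char_poly A.
Proof.
move=> PP; rewrite /char_poly.
have -> : char_poly_mx (P *m A *m P^T) =
    map_mx polyC P *m char_poly_mx A *m (map_mx polyC P)^T.
  rewrite /char_poly_mx mulmxBr mulmxBl mul_mx_scalar -scalemxAl map_trmx.
  by rewrite -!map_mxM/= PP map_mx1 scalemx1.
rewrite !det_mulmx mulrAC -det_mulmx map_trmx -map_mxM /= PP map_mx1 det1.
by rewrite mul1r.
Qed.

Lemma eigenvals_diag n (A P : 'M[R]_n) (e : 'rV[R]_n) : A^T = A ->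
  P *m P^T = 1%:M -> P *m A *m P^T = diag_mx e ->
  perm_eq (eigenvals A) [seq e 0 j | j <- enum 'I_n].
Proof.
move=> symA PP PAP; apply: perm_prod_XsubC.
rewrite -char_poly_eigenvals// -(char_poly_conj A PP) PAP.
rewrite char_poly_trig ?diag_mx_is_trig// big_map big_enum /=.
by apply: eq_bigr => i _; rewrite mxE eqxx.
Qed.

(** In a decreasing list the entries that are at least [c] form a prefix, so comparing one entry
    with [c] amounts to counting. *)
Lemma sorted_ge_nth (s : seq R) (c : R) (i : nat) : sorted >=%R s ->
  (i < size s)%N -> (c <= s`_i) = (i < count (>= c) s)%N.
Proof.
elim: s i => // x s IHs i xs.
have all_le : all (<= x) s by apply: order_path_min xs => a b c' /= ba /le_trans; apply.
have [cx|xc] := leP c x.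
  case: i => [|i] /=; rewrite cx //= ltnS add1n ltnS => si.
  by rewrite IHs// (path_sorted xs).
have -> : count (>= c) (x :: s) = 0%N.
  rewrite /= leNgt xc add0n; apply/eqP; rewrite -leqn0 leqNgt -has_count.
  apply/hasPn => y /(allP all_le) /= yx; rewrite -ltNge.
  exact: le_lt_trans xc.
case: i => [|i] /=; first by rewrite leNgt xc.
rewrite ltnS => si; have /(allP all_le) /= yx := mem_nth 0 si.
by apply/negbTE; rewrite -ltNge; exact: le_lt_trans xc.
Qed.

(** Counting makes it unnecessary to sort the eigenbasis [P] along [lambda]. The index shift in
    [lambda] turns the strict bound on positions into i <= #|...|. *)
Lemma lambda_ge_card n (A P : 'M[R]_n) (e : 'rV[R]_n) (i : nat) (c : R) :
  A^T = A -> P *m P^T = 1%:M -> P *m A *m P^T = diag_mx e ->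
  (1 <= i <= n)%N -> (c <= lambda i A) = (i <= #|[pred j | (c <= e 0 j)%R]|)%N.
Proof.
move=> symA PP PAP /andP[i0 lein].
rewrite /lambda sorted_ge_nth ?eigenvals_sorted ?size_eigenvals ?prednK//.
have /permP -> := eigenvals_diag symA PP PAP.
by rewrite count_map cardE enumT size_filter.
Qed.

Lemma spectral_span n (A P : 'M[R]_n) (e : 'rV[R]_n) (J : {pred 'I_n}) :
  P *m P^T = 1%:M -> P *m A *m P^T = diag_mx e ->
  exists (B : 'M[R]_(#|J|, n)) (f : 'I_#|J| -> 'I_n),
    [/\ forall k, f k \in J, B *m B^T = 1%:M &
        B *m A *m B^T = diag_mx (\row_k e 0 (f k))].
Proof.
move=> PP PAP; exists (rowsub enum_val P), enum_val.
have sub (M : 'M[R]_n) : rowsub enum_val P *m M *m (rowsub enum_val P)^T =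
    mxsub (@enum_val _ J) enum_val (P *m M *m P^T).
  apply/matrixP => i j; rewrite !mxE; apply: eq_bigr => k _; rewrite !mxE.
  by congr (_ * _); apply: eq_bigr => l _; rewrite !mxE.
split; first exact: enum_valP.
  rewrite -[X in X *m _]mulmx1 sub mulmx1 PP.
  by apply/matrixP => i j; rewrite !mxE (inj_eq enum_val_inj).
by rewrite sub PAP; apply/matrixP => i j; rewrite !mxE (inj_eq enum_val_inj).
Qed.

Lemma mxrank_orthonormal k n (B : 'M[R]_(k, n)) :
  B *m B^T = 1%:M -> \rank B = k.
Proof. by move=> BB; apply/eqP; apply/row_freeP; exists B^T. Qed.

Lemma quad_span k n (A : 'M[R]_n) (B : 'M[R]_(k, n)) (e : 'rV[R]_k)
    (a : 'rV[R]_k) : B *m B^T = 1%:M -> B *m A *m B^T = diag_mx e ->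
  quad A (a *m B) = \sum_j e 0 j * a 0 j ^+ 2 /\
  rdot (a *m B) (a *m B) = \sum_j a 0 j ^+ 2.
Proof.
move=> BB BAB; split; last first.
  by rewrite /rdot trmx_mul mulmxA -(mulmxA a) BB mulmx1 -/(rdot a a) rdot_sqr.
have -> : quad A (a *m B) = quad (diag_mx e) a.
  by rewrite /quad trmx_mul -BAB !mulmxA.
rewrite /quad mxE; apply: eq_bigr => j _; rewrite !mxE (bigD1 j)//= big1.
  by rewrite mxE eqxx addr0 mulr1n; ring.
by move=> l lj; rewrite mxE (negPf lj) mulr0n mulr0.
Qed.

(** One half of Courant-Fischer. If fewer than [i] eigenvalues reach [c], the eigenvectors with
    eigenvalue below [c] span more than n - i dimensions, hence meet [U] in a nonzero vector, on
    which the form is strictly below c |u|^2. *)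
Lemma le_lambda n k (A : 'M[R]_n) (U : 'M[R]_(k, n)) (i : nat) (c : R) :
  A^T = A -> (1 <= i <= n)%N -> (i <= \rank U)%N ->
  (forall u : 'rV[R]_n, (u <= U)%MS -> c * rdot u u <= quad A u) ->
  c <= lambda i A.
Proof.
move=> symA i1n iU UA; have [P [e [PP PAP]]] := sym_spectral symA.
rewrite (lambda_ge_card _ symA PP PAP)// leqNgt; apply/negP => Ji.
pose J := [pred j | e 0 j < c].
have [B [f [fJ BB BAB]]] := spectral_span J PP PAP.
have cJ : (#|J| + #|[pred j | (c <= e 0 j)%R]| = n)%N.
  rewrite -[RHS](card_ord n) -(cardC J); congr (_ + _)%N.
  by apply: eq_card => j; rewrite !inE leNgt.
have := mxrank_sum_cap U B; rewrite (mxrank_orthonormal BB) => rk.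
have cap0 : (U :&: B)%MS != 0.
  apply: contraTneq Ji => cap0; rewrite -leqNgt.
  move: rk; rewrite cap0 mxrank0 addn0 => rk.
  have := rank_leq_col (U + B)%MS; rewrite rk -[X in (_ <= X)%N]cJ => h.
  rewrite -(leq_add2l #|J|); apply: leq_trans h.
  by rewrite addnC leq_add2r.
have /rowV0Pn[u] := cap0; rewrite sub_capmx => /andP[uU /submxP[a ua]] u0.
have := UA u uU; apply/negP; rewrite -ltNge.
have [q d] := quad_span a BB BAB; rewrite ua q d mulr_sumr.
have a0 : a != 0 by apply: contraNneq u0 => a0; rewrite ua a0 mul0mx.
have [j aj] : exists j, a 0 j != 0.
  by apply/rV0Pn.
have lt_j l : e 0 (f l) < c by have := fJ l; rewrite inE.
rewrite (bigD1 j)//= [ltRHS](bigD1 j)//= ltr_leD//.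
  by rewrite mxE ltr_pM2r// lt_neqAle eq_sym sqrf_eq0 aj sqr_ge0.
by apply: ler_sum => l _; rewrite mxE ler_wpM2r ?sqr_ge0// ltW.
Qed.

(** The other half: the span of all eigenvectors with eigenvalue at least [lambda i A]. Its
    dimension exceeds [i] when this eigenvalue is repeated beyond position [i]. *)
Lemma lambda_space n (A : 'M[R]_n) (i : nat) : A^T = A -> (1 <= i <= n)%N ->
  exists k (U : 'M[R]_(k, n)), (i <= \rank U)%N /\
  forall u : 'rV[R]_n, (u <= U)%MS -> lambda i A * rdot u u <= quad A u.
Proof.
move=> symA i1n; have [P [e [PP PAP]]] := sym_spectral symA.
have [B [f [fJ BB BAB]]] :=
  spectral_span [pred j | (lambda i A <= e 0 j)%R] PP PAP.
exists _, B; split.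
  by rewrite (mxrank_orthonormal BB) -(lambda_ge_card _ symA PP PAP).
move=> u /submxP[a ->]; have [-> ->] := quad_span a BB BAB.
rewrite mulr_sumr; apply: ler_sum => l _; rewrite mxE ler_wpM2r ?sqr_ge0//.
by have := fJ l; rewrite inE.
Qed.

(** The subspace optimal for [A] is a test subspace for [B]. With c = 0 this gives monotonicity and
    scaling, with b = 1 the Lipschitz bound used for measurability. *)
Lemma le_lambda_shift n (A B : 'M[R]_n) (i : nat) (c b : R) :
  A^T = A -> B^T = B -> (1 <= i <= n)%N ->  0 < b ->
  (forall u : 'rV[R]_n, quad A u <= b * quad B u + c * rdot u u) ->
  lambda i A <= b * lambda i B + c.
Proof.
move=> symA symB i1n b0 AB; have [k [U [iU UA]]] := lambda_space symA i1n.
rewrite -lerBlDr mulrC -ler_pdivrMr//; apply: le_lambda iU _ => // u uU.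
rewrite mulrAC ler_pdivrMr// mulrBl lerBlDr [X in X + _]mulrC.
exact: le_trans (UA u uU) (AB u).
Qed.

Lemma quad_mulmx n k (Z : 'M[R]_(n, k)) (u : 'rV[R]_n) :
  quad (Z *m Z^T) u = rdot (u *m Z) (u *m Z).
Proof. by rewrite /quad /rdot trmx_mul !mulmxA. Qed.

Lemma quad_sqr n (S : 'M[R]_n) (u : 'rV[R]_n) : S^T = S ->
  quad (S *m S) u = rdot (u *m S) (u *m S).
Proof. by move=> symS; rewrite -{2}symS quad_mulmx. Qed.

Lemma rdot_mulmx n k (Z : 'M[R]_(n, k)) u v :
  rdot (u *m Z) v = rdot u (v *m Z^T).
Proof. by rewrite /rdot trmx_mul trmxK mulmxA. Qed.

Lemma quadE n (A : 'M[R]_n) (u : 'rV[R]_n) : quad A u = rdot (u *m A) u.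
Proof. by []. Qed.

Lemma rdotZl n (u v : 'rV[R]_n) c : rdot (c *: u) v = c * rdot u v.
Proof. by rewrite /rdot -scalemxAl mxE. Qed.

Lemma rdotZr n (u v : 'rV[R]_n) c : rdot u (c *: v) = c * rdot u v.
Proof. by rewrite rdotC rdotZl rdotC. Qed.

Lemma lambda_psd_ge0 n k (Z : 'M[R]_(n, k)) (i : nat) : (1 <= i <= n)%N ->
  0 <= lambda i (Z *m Z^T).
Proof.
move=> i1n; apply: (@le_lambda _ _ _ 1%:M) => //.
- by rewrite trmx_mul trmxK.
- by rewrite mxrank1; case/andP: i1n.
- by move=> u _; rewrite mul0r quad_mulmx rdot_ge0.
Qed.

(** A matrix and its transpose have the same operator norm. Without singular values: with x = w Z^T,
    expand 0 <= |c w - x Z|^2, where the cross term is -2 c |x|^2 and |x Z|^2 <= c |x|^2. *)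
Lemma rdot_trmx_le n d (Z : 'M[R]_(n, d)) (c : R) : 0 < c ->
  (forall v : 'rV[R]_n, rdot (v *m Z) (v *m Z) <= c * rdot v v) ->
  forall w : 'rV[R]_d, rdot (w *m Z^T) (w *m Z^T) <= c * rdot w w.
Proof.
move=> c0 Zc w; set x := w *m Z^T.
have := rdot_ge0 (c *: w - x *m Z).
rewrite rdotBl !rdotBr !rdotZl !rdotZr (rdot_mulmx Z x) -/x.
rewrite (rdotC w (x *m Z)) rdot_mulmx -/x => h.
have {}h : c * rdot x x <= c * (c * rdot w w) by have := Zc x; lra.
by rewrite ler_pM2l in h.
Qed.

(** The lower bound passes to Z^T only on the row space of [Z], since Z^T has a kernel when n < d.
    With x = v Z Z^T, expand 0 <= |x - c v|^2, where <v, x> = |v Z|^2 and c^2 |v|^2 <= c |v Z|^2. *)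
Lemma rdot_gram_ge n d (Z : 'M[R]_(n, d)) (c : R) : 0 <= c ->
  (forall v : 'rV[R]_n, c * rdot v v <= rdot (v *m Z) (v *m Z)) ->
  forall v : 'rV[R]_n, c * rdot (v *m Z) (v *m Z) <=
    rdot (v *m Z *m Z^T) (v *m Z *m Z^T).
Proof.
move=> c0 Zc v; set x := v *m Z *m Z^T.
have := rdot_ge0 (x - c *: v).
rewrite rdotBl !rdotBr !rdotZl !rdotZr (rdotC x v).
have <- : rdot (v *m Z) (v *m Z) = rdot v x by rewrite rdot_mulmx.
have := ler_wpM2l c0 (Zc v); lra.
Qed.

Lemma lambda_gram_le n d (S : 'M[R]_d) (Z : 'M[R]_(n, d)) (i : nat) (c : R) :
  S^T = S -> (1 <= i <= d)%N -> 0 < c ->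
  (forall v : 'rV[R]_n, rdot (v *m Z) (v *m Z) <= c * rdot v v) ->
  lambda i (S *m Z^T *m (S *m Z^T)^T) <= c * lambda i (S *m S).
Proof.
move=> symS i1d c0 Zc; rewrite -[leRHS]addr0; apply: le_lambda_shift => //.
- by rewrite trmx_mul trmxK.
- by rewrite trmx_mul symS.
move=> u; rewrite mul0r addr0 quad_sqr// quad_mulmx mulmxA.
exact: rdot_trmx_le.
Qed.

(* Witness subspace: the top eigenspace of S^2 of dimension i + d - n meets
   { u | u S in the row space of Z }, of dimension n, in dimension >= i. *)
Lemma lambda_gram_ge n d (S : 'M[R]_d) (Z : 'M[R]_(n, d)) (i : nat) (c : R) :
  S^T = S -> S \in unitmx -> (n <= d)%N -> (1 <= i <= n)%N -> 0 < c ->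
  (forall v : 'rV[R]_n, c * rdot v v <= rdot (v *m Z) (v *m Z)) ->
  c * lambda (i + d - n) (S *m S) <= lambda i (S *m Z^T *m (S *m Z^T)^T).
Proof.
move=> symS unitS nd /andP[i0 iln] c0 Zc.
have symSS : (S *m S)^T = S *m S by rewrite trmx_mul symS.
have idn : (1 <= i + d - n <= d)%N by lia.
have [k [U [iU UA]]] := lambda_space symSS idn.
pose W := Z *m invmx S.
have rW : \rank W = n.
  rewrite mxrankMfree ?row_free_unit ?unitmx_inv//; apply/eqP.
  apply: inj_row_free => v vZ; apply/eqP.
  rewrite -rdot_eq0 eq_le rdot_ge0 andbT -(pmulr_rle0 _ c0).
  by apply: le_trans (Zc v) _; rewrite vZ /rdot mul0mx mxE.
apply: (@le_lambda _ _ _ (U :&: W)%MS).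
- by rewrite trmx_mul trmxK.
- by rewrite i0 (leq_trans iln nd).
- have := mxrank_sum_cap U W; have := rank_leq_col (U + W)%MS.
  rewrite rW; move: (\rank _) (\rank _) (\rank _) iU => a b e; lia.
move=> u; rewrite sub_capmx => /andP[uU /submxP[v uv]].
have uS : u *m S = v *m Z by rewrite uv /W mulmxA mulmxKV.
have -> : quad (S *m Z^T *m (S *m Z^T)^T) u =
    rdot (v *m Z *m Z^T) (v *m Z *m Z^T) by rewrite quad_mulmx mulmxA uS.
apply: le_trans (rdot_gram_ge (ltW c0) Zc v).
rewrite -mulrA ler_pM2l// -uS.
by have := UA u uU; rewrite quad_sqr.
Qed.
End spectral.

(** * Quadratic forms on a lattice net of the unit ball *)

Section net.
Variable R : realType.

(** Let [m] be the largest absolute eigenvalue, [p] a unit eigenvector for it and [y] a net point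
    within 1/4 of [p]. The forms at [p] and [y] differ by <(p - y) A, p + y>, at most m/4 * 2 = m/2,
    so m <= m/2 + c/2. *)
Lemma quad_le_net n (A : 'M[R]_n) (N : set 'rV[R]_n) (c : R) : A^T = A ->
  (forall y, N y -> rdot y y <= 1) ->
  (forall x, rdot x x = 1 -> exists2 y, N y & rdot (x - y) (x - y) <= 16^-1) ->
  (forall y, N y -> `|quad A y| <= c / 2) ->
  forall x, `|quad A x| <= c * rdot x x.
Proof.
case: n A N => [|n] A N symA N1 Nd NA x.
  have -> : x = 0 by apply/rowP => -[].
  by rewrite /quad /rdot !mul0mx !mxE normr0 mulr0.
have [P [e [PP PAP]]] := sym_spectral symA.
have [j _ jmax] := @arg_maxP _ _ _ ord0 xpredT (fun j => `|e 0 j|) isT.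
set m := `|e 0 j| in jmax.
have quad_m (u : 'rV[R]_n.+1) : `|quad A u| <= m * rdot u u.
  have [] := quad_span (u *m P^T) PP PAP.
  rewrite -mulmxA (mulmx1C PP) mulmx1 => -> ->.
  rewrite mulr_sumr; apply: le_trans (ler_norm_sum _ _ _) _.
  apply: ler_sum => l _; rewrite normrM [X in _ * X]ger0_norm ?sqr_ge0//.
  by rewrite ler_wpM2r ?sqr_ge0//; exact: jmax.
suff mc : m <= c by rewrite (le_trans (quad_m x))// ler_wpM2r ?rdot_ge0.
pose p := row j P.
have [] := quad_span (delta_mx 0 j) PP PAP.
have d1 : \sum_l (delta_mx 0 j : 'rV[R]_n.+1) 0 l ^+ 2 = 1.
  by rewrite (bigD1 j)//= big1 ?mxE ?eqxx ?expr1n ?addr0// => l lj;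
    rewrite mxE (negPf lj) andbF expr0n.
rewrite d1 (bigD1 j)//= big1; last first.
  by move=> l lj; rewrite mxE (negPf lj) andbF expr0n mulr0.
rewrite mxE !eqxx expr1n mulr1 addr0 -rowE -/p => pe p1.
have [y Ny py] := Nd _ p1.
have := N1 _ Ny; have := NA _ Ny => Ay y1.
pose a := p - y; pose b := p + y.
have par (u v : 'rV[R]_n.+1) : rdot (u + v) (u + v) + rdot (u - v) (u - v) =
    2 * (rdot u u + rdot v v).
  rewrite !rdot_sqr -!big_split /= mulr_sumr; apply: eq_bigr => l _.
  by rewrite !mxE; ring.
have b4 : rdot b b <= 4 by have := par p y; have := rdot_ge0 a; rewrite -/a -/b; lra.
have pol (u v : 'rV[R]_n.+1) :
    quad A (u + v) - quad A (u - v) = 4 * rdot (u *m A) v.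
  have vAu : rdot (v *m A) u = rdot (u *m A) v.
    by rewrite rdot_mulmx symA rdotC.
  by rewrite !quadE mulmxDl mulmxBl !(rdotBl, rdotDl, rdotBr, rdotDr) vAu; ring.
have ab : quad A p - quad A y = rdot (a *m A) b.
  by rewrite /a /b mulmxBl rdotBl !rdotDr -!quadE (rdot_mulmx A y) symA rdotC; ring.
(* Polarisation stands in for Cauchy-Schwarz. The factor 8 balances the two vectors, both then of
   length at most 2: 32 |<a A, b>| <= 2 m (64 |a|^2 + |b|^2) <= 16 m. *)
have := pol (8 *: a) b.
rewrite -scalemxAl rdotZl -ab pe => pab.
have hp := quad_m (8 *: a + b); have hm := quad_m (8 *: a - b).
have := par (8 *: a) b; rewrite rdotZl rdotZr => parab.
have m0 : 0 <= m by rewrite /m.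
have : `|4 * (8 * (e 0 j - quad A y))| <= 16 * m.
  rewrite -pab (le_trans (ler_normB _ _))//.
  rewrite (le_trans (lerD hp hm))// -mulrDr parab mulrC ler_wpM2r//.
  by rewrite -/a in py; lra.
rewrite mulrA normrM ger0_norm// => h.
have : m <= `|e 0 j - quad A y| + `|quad A y|.
  by rewrite /m -[X in `|X| <= _](subrK (quad A y)) ler_normD.
lra.
Qed.

(* Lattice points of mesh (4 sqrt n)^-1, as signs and absolute values;
   rounding towards 0 keeps the approximants inside the unit ball. *)
Definition net_point n (f : {ffun 'I_n -> bool * 'I_(16 * n).+1}) : 'rV[R]_n :=
  \row_i ((-1) ^+ (f i).1 * (f i).2%:R / (4 * Num.sqrt n%:R)).

(** The condition |y|^2 <= 1 multiplied by (4 sqrt n)^2, so that it reads in [nat]. It forces k <=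
    k^2 <= 16 n, hence the range of the absolute values. A zero coordinate has two encodings,
    harmless for an upper bound on the cardinality. *)
Definition net n : {set {ffun 'I_n -> bool * 'I_(16 * n).+1}} :=
  [set f : {ffun 'I_n -> bool * 'I_(16 * n).+1} |
    (\sum_i (f i).2 ^ 2 <= 16 * n)%N].

Lemma net_le1 n f : f \in net n -> rdot (net_point f) (net_point f) <= 1.
Proof.
case: n f => [|n] f; first by rewrite rdot_sqr big_ord0.
rewrite inE -(ler_nat R) natr_sum => fn.
rewrite rdot_sqr.
under eq_bigr => i _.
  rewrite mxE !exprMn exprVn sqrr_sign mul1r exprMn sqr_sqrtr// -natrX.
  over.
rewrite -mulr_suml ler_pdivrMr; last by rewrite mulr_gt0// ?ltr0n//; lra.
by rewrite mul1r (le_trans fn)// natrM; lra.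
Qed.

(** Truncating each coordinate to the mesh errs by at most 1/(4 sqrt n), and [n] squared errors add
    up to at most 1/16. *)
Lemma net_approx n (x : 'rV[R]_n) : rdot x x = 1 ->
  exists2 f, f \in net n & rdot (x - net_point f) (x - net_point f) <= 16^-1.
Proof.
case: n x => [|n] x x1.
  by move: x1; rewrite rdot_sqr big_ord0 => /esym/eqP; rewrite oner_eq0.
pose s : R := 4 * Num.sqrt n.+1%:R.
have s0 : 0 < s by rewrite mulr_gt0// sqrtr_gt0 ltr0n.
have s2 : s ^+ 2 = 16 * n.+1%:R by rewrite exprMn sqr_sqrtr//; ring.
pose k i := Num.truncn (s * `|x 0 i|).
have kP i : (k i)%:R <= s * `|x 0 i| < (k i).+1%:R.
  by apply: truncn_itv; rewrite mulr_ge0 ?(ltW s0).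
have sumk : (\sum_i k i ^ 2 <= 16 * n.+1)%N.
  rewrite -(ler_nat R) natr_sum [leRHS]natrM -s2 -[leRHS]mulr1.
  rewrite -[X in _ <= _ * X]x1 rdot_sqr mulr_sumr.
  apply: ler_sum => i _; rewrite natrX -exprMn -[leRHS]real_normK ?num_real//.
  rewrite normrM (gtr0_norm s0) ler_sqr ?nnegrE ?ler0n ?mulr_ge0 ?(ltW s0)//.
  by have /andP[] := kP i.
have klt i : (k i < (16 * n.+1).+1)%N.
  rewrite ltnS (leq_trans _ sumk)// (bigD1 i)//= (leq_trans _ (leq_addr _ _))//.
  by case: (k i) => // m; rewrite leq_pmulr.
exists [ffun i => (x 0 i < 0, Ordinal (klt i))].
  by rewrite inE; under eq_bigr do rewrite ffunE /=.
rewrite rdot_sqr (@le_trans _ _ (\sum_(i < n.+1) (s ^+ 2)^-1))//; last first.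
  rewrite sumr_const card_ord -[leLHS]mulr_natr s2 invfM -mulrA mulVf ?mulr1// pnatr_eq0.
apply: ler_sum => i _; rewrite !mxE ffunE /= -/s.
rewrite -exprVn -[leLHS]real_normK ?num_real// ler_sqr ?nnegrE ?invr_ge0 ?(ltW s0)//.
have -> : x 0 i - (-1) ^+ (x 0 i < 0)%R * (k i)%:R / s =
    (-1) ^+ (x 0 i < 0)%R * (s * `|x 0 i| - (k i)%:R) / s.
  by rewrite {1}[x 0 i]realEsign ?num_real//; field; rewrite gt_eqF.
rewrite normrM normrM normr_sign mul1r normfV (gtr0_norm s0).
rewrite ler_pdivrMr// mulVf ?gt_eqF//.
have := kP i; rewrite -natr1 => /andP[k1 k2].
by rewrite ger0_norm; lra.
Qed.

(* Give k in Z the weight 2^-|k|, of total mass at most 4: since |k| <= k^2,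
   each point of the net has weight at least 2^-(16 n). *)
Lemma card_net n : (#|net n| <= 2 ^ (18 * n))%N.
Proof.
pose w (p : bool * 'I_(16 * n).+1) : R := 2^-1 ^+ p.2.
have w_ge0 p : 0 <= w p by rewrite exprn_ge0// invr_ge0.
have sumw : \sum_p w p <= 4.
  rewrite -(pair_bigA _ (fun b k => w (b, k))) /= big_bool /w /=.
  suff : \sum_(k < (16 * n).+1) (2^-1 : R) ^+ k <= 2 by lra.
  elim: (16 * n).+1 => [|q IHq]; first by rewrite big_ord0.
  rewrite big_ord_recl expr0; under eq_bigr do rewrite /= exprS.
  by rewrite -mulr_sumr; lra.
rewrite -(ler_nat R) -sum1_card natr_sum.
apply: (@le_trans _ _ (\sum_(f in net n) 2 ^+ (16 * n) * \prod_i w (f i))).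
  apply: ler_sum => f; rewrite inE => fn.
  rewrite /w prodrXr exprVn ler_pdivlMr ?exprn_gt0// mul1r ler_eXn2l ?ltr1n//.
  apply: leq_trans fn; apply: leq_sum => i _.
  by case: ((f i).2 : nat) => // q; rewrite leq_pmulr.
rewrite -mulr_sumr.
(* Without the constraint the sum of products factors over the coordinates: at most 4^n, and 2^(16
   n) 4^n = 2^(18 n). *)
apply: (@le_trans _ _ (2 ^+ (16 * n) *
  \sum_(f : {ffun 'I_n -> bool * 'I_(16 * n).+1}) \prod_i w (f i))).
  rewrite ler_wpM2l ?exprn_ge0// [leRHS](bigID [in net n])/= lerDl.
  by apply: sumr_ge0 => f _; apply: prodr_ge0.
rewrite -(bigA_distr_bigA (fun _ => w)) /= prodr_const card_ord.
rewrite natrX (mulnDl 16 2) exprD ler_wpM2l ?exprn_ge0// exprM.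
rewrite lerXn2r ?nnegrE ?sumr_ge0//; first by rewrite expr2; lra.
Qed.

End net.

(** * Measurability of [lambda] *)

Section measurable_lambda.
Context (d : measure_display) (T : measurableType d) (R : realType).

(** Since |u_j u_k| <= (u_j^2 + u_k^2)/2, an entrywise error [q] changes the quadratic form by at
    most n q |u|^2. *)
Lemma lambda_perturb n (A B : 'M[R]_n) (i : nat) (q : R) :
  A^T = A -> B^T = B -> (1 <= i <= n)%N ->
  (forall j k, `|A j k - B j k| <= q) ->
  lambda i A <= lambda i B + n%:R * q.
Proof.
move=> symA symB i1n ABq; rewrite -[X in _ <= X + _]mul1r.
apply: le_lambda_shift => // u; rewrite mul1r -lerBlDl.
have -> : quad A u - quad B u = \sum_k \sum_j u 0 j * (A j k - B j k) * u 0 k.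
  rewrite !quadE -rdotBl -mulmxBr rdotE; apply: eq_bigr => k _.
  by rewrite mxE mulr_suml; apply: eq_bigr => j _; rewrite !mxE.
apply: (@le_trans _ _ (\sum_k \sum_j q * ((u 0 j ^+ 2 + u 0 k ^+ 2) / 2))).
  apply: ler_sum => k _; apply: ler_sum => j _.
  rewrite mulrAC mulrC; apply: le_trans (ler_norm _) _; rewrite normrM.
  apply: ler_pM => //.
  rewrite normrM -(real_normK (num_real (u 0 j))) -(real_normK (num_real (u 0 k))).
  by have := sqr_ge0 (`|u 0 j| - `|u 0 k|); rewrite sqrrB; lra.
rewrite rdot_sqr.
under eq_bigr => k _ do rewrite -mulr_sumr -mulr_suml big_split /= sumr_const card_ord.
rewrite -mulr_sumr -mulr_suml big_split /= sumr_const card_ord sumrMnl.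
rewrite -mulr2n -mulr_natl -[X in _ * (X / _)]mulr_natl le_eqVlt.
by apply/orP; left; apply/eqP; field.
Qed.

Lemma measurable_forall (I : finType) (F : I -> set T) :
  (forall i, measurable (F i)) -> measurable [set w | forall i, F i w].
Proof.
move=> mF; rewrite (_ : [set _ | _] = \big[setI/setT]_(i : I) F i).
  by apply: bigsetI_measurable => i _; exact: mF.
rewrite -bigcap_seq; apply/seteqP; split => w /= Fw i; first by move=> _; exact: Fw.
by apply: Fw; rewrite /= mem_index_enum.
Qed.

Lemma measurable_le_const (f : T -> R) (c : R) : measurable_fun setT f ->
  measurable [set w | f w <= c].
Proof.
move=> mf; rewrite -[X in measurable X]setTI.
rewrite (_ : [set _ | _] = f @^-1` `]-oo, c]); first exact: mf.
by apply/seteqP; split => w /=; rewrite in_itv.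
Qed.

(* P is additive only on measurable sets, so the event of the theorem has to be
   shown measurable; [lambda] is Lipschitz, hence determined by rational
   approximations of the matrix. *)
Lemma measurable_lambda n (M : T -> 'M[R]_n) (i : nat) :
  (1 <= i <= n)%N -> (forall w, (M w)^T = M w) ->
  (forall j k, measurable_fun setT (fun w => M w j k)) ->
  measurable_fun setT (fun w => lambda i (M w)).
Proof.
move=> i1n symM mM; apply: (measurability _ (RGenOInfty.measurableE R)) => //.
move=> _ [_ [c ->] <-]; rewrite setTI.
have n0 : 0 < n%:R :> R by rewrite ltr0n; lia.
pose Q (p : 'M[rat]_n * rat) : 'M[R]_n := map_mx ratr p.1.
pose D : set ('M[rat]_n * rat) :=
  [set p | (Q p)^T = Q p /\ c + n%:R * ratr p.2 < lambda i (Q p)].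
have -> : (fun w => lambda i (M w)) @^-1` `]c, +oo[ =
    \bigcup_p [set w | D p /\
      forall jk : 'I_n * 'I_n, `|M w jk.1 jk.2 - Q p jk.1 jk.2| <= ratr p.2].
  apply/seteqP; split => w /=; rewrite in_itv /= andbT.
    (* The Lipschitz error n q must fit twice into the gap above [c]: once to pass from [M w] to the
       rational matrix, once for the margin that [D] demands for the way back. *)
    move=> clt; pose q0 := (lambda i (M w) - c) / (2 * n%:R).
    have q00 : 0 < q0 by rewrite divr_gt0 ?subr_gt0// mulr_gt0.
    have [q] := rat_in_itvoo q00; rewrite in_itv /= => /andP[q_gt0 qlt].
    have qlt2 : 2 * (n%:R * ratr q) < lambda i (M w) - c.
      by rewrite mulrA mulrC -ltr_pdivlMr ?mulr_gt0.
    (* The approximant is a function of the value of the entry, not of its position, so the rational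
       matrix inherits the symmetry of [M w]. *)
    have /choice[f fP] : forall x : R, exists r : rat, `|x - ratr r| <= ratr q.
      move=> x; have [r] : exists r, ratr r \in `]x, x + ratr q[.
        by apply: rat_in_itvoo; rewrite ltrDl.
      by rewrite in_itv /= => /andP[? ?]; exists r; rewrite ler_distlC; lra.
    pose F := \matrix_(j, k) f (M w j k).
    have sQ : (Q (F, q))^T = Q (F, q).
      by apply/matrixP => j k; rewrite !mxE -[in M w k j]symM mxE.
    have MQ j k : `|M w j k - Q (F, q) j k| <= ratr q by rewrite !mxE.
    exists (F, q); first exact: I.
    split; last by case=> j k; exact: MQ.
    split; first exact: sQ.
    move: qlt2 (lambda_perturb (symM w) sQ i1n MQ) => /=.
    move: (n%:R * ratr q) (lambda i (M w)) (lambda i (Q (F, q))) => r p p'.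
    by clear; lra.
  move=> [p _ [[sQ clt] MQ]].
  have := @lambda_perturb _ _ _ i (ratr p.2) sQ (symM w) i1n.
  move=> h; rewrite -(ltrD2r (n%:R * ratr p.2)); apply: lt_le_trans clt _.
  by apply: h => j k; rewrite distrC; exact: (MQ (j, k)).
apply: countable_bigcupT_measurable => [|p]; first exact: countableP.
have [Dp|Dp] := pselect (D p); last first.
  by rewrite (_ : [set _ | _] = set0)//; apply/seteqP; split => // w [].
rewrite (_ : [set _ | _] = [set w | forall jk : 'I_n * 'I_n,
    `|M w jk.1 jk.2 - Q p jk.1 jk.2| <= ratr p.2]); last first.
  by apply/seteqP; split => w /=; [case|].
apply: measurable_forall => jk; apply: measurable_le_const.
by apply: measurableT_comp => //; apply: measurable_funB.
Qed.

End measurable_lambda.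

(** * Independence of blocks *)

Section independence.
Context (d : measure_display) (T : measurableType d) (R : realType).
Context (P : probability T R) (I : finType).
Context (d' : measure_display) (U : measurableType d') (Y : I -> T -> U).
Hypothesis mY : forall i, measurable_fun setT (Y i).
Hypothesis indY : mutually_independent P Y.

Definition cylinders (D : {set I}) : set (set T) :=
  [set A | exists2 B : I -> set U, (forall i, measurable (B i)) &
           A = \bigcap_(i in [set` D]) (Y i @^-1` B i)].

(** [T] equipped with the sigma-algebra generated by the [Y i], i in [D]: depending only on the
    block [D] becomes measurability on this type. *)
Definition sigmaT (D : {set I}) := g_sigma_algebraType (cylinders D).

Lemma cylinders_measurable D : cylinders D `<=` measurable.
Proof.
move=> _ [B mB ->]; apply: fin_bigcap_measurable => // i _.
by rewrite -[X in measurable X]setTI; exact: mY.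
Qed.

Lemma cylinders_setI D : setI_closed (cylinders D).
Proof.
move=> _ _ [B mB ->] [C mC ->]; exists (fun i => B i `&` C i).
  by move=> i; exact: measurableI.
apply/seteqP; split => w /=; first by move=> [Bw Cw] i Di; split; [exact: Bw|exact: Cw].
by move=> BCw; split => i Di; have [] := BCw i Di.
Qed.

Lemma cylinders_setT D : cylinders D setT.
Proof. by exists (fun=> setT) => //; rewrite bigcapT. Qed.

Lemma cylinders_sub (D D' : {set I}) :
  D \subset D' -> cylinders D `<=` cylinders D'.
Proof.
move=> /fintype.subsetP DD' _ [B mB ->].
exists (fun i => if i \in D then B i else setT) => [i|]; first by case: ifP.
apply/seteqP; split => w /= Bw i.
  by move=> _; case: ifP => // Di; exact: Bw.
by move=> /[dup] /DD' /Bw + Di; rewrite Di; apply.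
Qed.

Lemma sigmaT_measurable D (A : set T) :
  <<s cylinders D >> A -> measurable A.
Proof.
by apply: smallest_sub; [exact: sigma_algebra_measurable|exact: cylinders_measurable].
Qed.

Lemma sigmaT_fun D d2 (V : measurableType d2) (F : T -> V) :
  measurable_fun (setT : set (sigmaT D)) F -> measurable_fun setT F.
Proof. by move=> mF _ B mB; apply: (@sigmaT_measurable D); exact: mF. Qed.

Lemma sigmaT_fun_sub (D D' : {set I}) d2 (V : measurableType d2) (F : T -> V) :
  D \subset D' -> measurable_fun (setT : set (sigmaT D)) F ->
  measurable_fun (setT : set (sigmaT D')) F.
Proof.
move=> DD' mF _ B mB; have : <<s cylinders D >> (setT `&` F @^-1` B) by exact: mF.
by apply: sub_sigma_algebra2; exact: cylinders_sub.
Qed.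

Lemma sigmaT_coord (D : {set I}) i :
  i \in D -> measurable_fun (setT : set (sigmaT D)) (Y i).
Proof.
move=> Di _ B mB; rewrite setTI; apply: sub_sigma_algebra.
exists (fun j => if j == i then B else setT) => [j|]; first by case: ifP.
apply/seteqP; split => w /= Bw; first by move=> j _; case: eqP => // ->.
by have := Bw i Di; rewrite eqxx.
Qed.

Lemma cylinders_indep (D1 D2 : {set I}) A1 A2 : [disjoint D1 & D2]%B ->
  cylinders D1 A1 -> cylinders D2 A2 -> P (A1 `&` A2) = (P A1 * P A2)%E.
Proof.
move=> D12 [B1 mB1 ->] [B2 mB2 ->].
pose B i := if i \in D1 then B1 i else B2 i.
have mB i : measurable (B i) by rewrite /B; case: ifP.
have -> : \bigcap_(i in [set` D1]) (Y i @^-1` B1 i) `&`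
    \bigcap_(i in [set` D2]) (Y i @^-1` B2 i) =
    \bigcap_(i in [set` D1 :|: D2]) (Y i @^-1` B i).
  apply/seteqP; split => w /=.
    move=> [Bw1 Bw2] i /=; rewrite finset.in_setU /B; case: ifP => [D1i _|_ /= D2i].
      exact: Bw1.
    exact: Bw2.
  move=> Bw; split => i Di.
    by have := Bw i; rewrite /B /= finset.in_setU Di; apply.
  by have := Bw i; rewrite /B /= finset.in_setU Di orbT (disjointFl D12 Di); apply.
rewrite !indY// (big_setID D1)/= finset.setUK finset.setDUl finset.setDv.
rewrite finset.set0U; congr (_ * _)%E.
  by apply: eq_bigr => i Di; rewrite /B Di.
have /finset.setDidPl -> : [disjoint D2 & D1]%B by rewrite disjoint_sym.
by apply: eq_bigr => i Di; rewrite /B (disjointFl D12 Di).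
Qed.

(** For fixed [A2], both A -> P (A [&] A2) and A -> P A * P A2 are finite measures. They agree on
    the cylinders, a pi-system containing the whole space, hence on the generated sigma-algebra. *)
Lemma indep_extend D (A2 : set T) : measurable A2 ->
  (forall A1, cylinders D A1 -> P (A1 `&` A2) = (P A1 * P A2)%E) ->
  forall A1, <<s cylinders D >> A1 -> P (A1 `&` A2) = (P A1 * P A2)%E.
Proof.
move=> mA2 indep A1 sA1.
have p0 : 0 <= fine (P A2) by rewrite fine_ge0.
pose m2 := mscale (NngNum p0) P.
have -> : (P A1 * P A2)%E = m2 A1.
  by rewrite /m2 /mscale /= fineK ?fin_num_measure// muleC.
apply: (@g_sigma_algebra_measure_unique _ _ _ (cylinders D) _ (fun=> setT) _ _
  (mrestr P mA2) m2) => //.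
- exact: cylinders_measurable.
- by move=> _; exact: cylinders_setT.
- by rewrite bigcup_const//; exists 0%N.
- exact: cylinders_setI.
- move=> A GA /=; rewrite /mrestr indep// /m2 /mscale /= fineK ?fin_num_measure//.
  by rewrite muleC.
- move=> k; rewrite /= /mrestr setTI.
  by rewrite (le_lt_trans (probability_le1 _ _))// ltry.
Qed.

Lemma sigmaT_indep (D1 D2 : {set I}) A1 A2 : [disjoint D1 & D2]%B ->
  <<s cylinders D1 >> A1 -> <<s cylinders D2 >> A2 ->
  P (A1 `&` A2) = (P A1 * P A2)%E.
Proof.
move=> D12 sA1 sA2; rewrite setIC muleC.
apply: indep_extend sA2; first exact: sigmaT_measurable sA1.
move=> B2 GB2; rewrite setIC muleC.
apply: indep_extend sA1; first exact: cylinders_measurable GB2.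
by move=> B1 GB1; exact: cylinders_indep GB1 GB2.
Qed.

Local Open Scope ereal_scope.

(* The joint law of (F1, F2) is the product of the marginals; conclude by Tonelli. *)
Lemma expectation_mul_indep (D1 D2 : {set I}) (F1 F2 : T -> R) :
  [disjoint D1 & D2]%B ->
  measurable_fun (setT : set (sigmaT D1)) F1 ->
  measurable_fun (setT : set (sigmaT D2)) F2 ->
  (forall w, 0 <= F1 w)%R -> (forall w, 0 <= F2 w)%R ->
  \int[P]_w (F1 w * F2 w)%:E = \int[P]_w (F1 w)%:E * \int[P]_w (F2 w)%:E.
Proof.
move=> D12 mF1 mF2 F10 F20.
have mf1 := sigmaT_fun mF1; have mf2 := sigmaT_fun mF2.
pose X1 : {mfun T >-> R} := HB.pack F1 (isMeasurableFun.Build _ _ _ _ _ mf1).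
pose X2 : {mfun T >-> R} := HB.pack F2 (isMeasurableFun.Build _ _ _ _ _ mf2).
have mX := measurable_fun_pair mf1 mf2.
pose X : {mfun T >-> (R * R)%type} :=
  HB.pack (fun w => (F1 w, F2 w)) (isMeasurableFun.Build _ _ _ _ _ mX).
(* Absolute values make the integrand nonnegative on the whole plane, as Tonelli requires; on the
   values of [F1] and [F2] they change nothing. *)
pose f (z : R * R) : \bar R := (`|z.1| * `|z.2|)%:E.
have mf : measurable_fun setT f.
  by apply/measurable_EFinP; apply: measurable_funM; exact: measurableT_comp.
have f0 z : 0 <= f z by rewrite lee_fin mulr_ge0.
transitivity (\int[P]_w (f \o X) w).
  by apply: eq_integral => w _; rewrite /f /= !ger0_norm.
rewrite -ge0_integral_distribution//.
rewrite (@eq_measure_integral _ _ _ _ (distribution P X1 \x distribution P X2)); last first.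
  move=> A mA _; apply/esym; apply: product_measure_unique => // B1 B2 mB1 mB2.
  rewrite /distribution /= /pushforward.
  apply: (sigmaT_indep D12).
    by rewrite -[X in <<s _ >> X]setTI; exact: mF1.
  by rewrite -[X in <<s _ >> X]setTI; exact: mF2.
rewrite fubini_tonelli1//= /fubini_F /=.
have E2 : \int[distribution P X2]_y `|y|%:E = \int[P]_w (F2 w)%:E.
  rewrite ge0_integral_distribution//; last by apply/measurable_EFinP.
  by apply: eq_integral => w _; rewrite /= ger0_norm.
have E1 : \int[distribution P X1]_y `|y|%:E = \int[P]_w (F1 w)%:E.
  rewrite ge0_integral_distribution//; last by apply/measurable_EFinP.
  by apply: eq_integral => w _; rewrite /= ger0_norm.
rewrite -E1 -E2.
under eq_integral => x _.
  rewrite /f /=; under eq_integral do rewrite EFinM.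
  rewrite ge0_integralZl//; last by apply/measurable_EFinP.
  over.
rewrite ge0_integralZr//; first by apply/measurable_EFinP.
by apply: integral_ge0.
Qed.

Lemma expectation_mul_indep0 (D1 D2 : {set I}) (F1 F2 : T -> R) :
  [disjoint D1 & D2]%B ->
  measurable_fun (setT : set (sigmaT D1)) F1 ->
  measurable_fun (setT : set (sigmaT D2)) F2 ->
  P.-integrable setT (EFin \o F1) -> P.-integrable setT (EFin \o F2) ->
  \int[P]_w (F1 w)%:E = 0 ->
  P.-integrable setT (fun w => (F1 w * F2 w)%:E) /\
  \int[P]_w (F1 w * F2 w)%:E = 0.
Proof.
move=> D12 mF1 mF2 intF1 intF2 F10.
(* Used in place of positive and negative parts: p - q = F is a ring identity. *)
pose q (F : T -> R) w := `|F w|%R; pose p (F : T -> R) w := (`|F w| + F w)%R.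
have q0 F w : (0 <= q F w)%R by exact: normr_ge0.
have p0 F w : (0 <= p F w)%R by rewrite -lerBlDr sub0r -normrN ler_norm.
have mq D F : measurable_fun (setT : set (sigmaT D)) F ->
    measurable_fun (setT : set (sigmaT D)) (q F) by move=> ?; exact: measurableT_comp.
have mp D F : measurable_fun (setT : set (sigmaT D)) F ->
    measurable_fun (setT : set (sigmaT D)) (p F).
  by move=> mF; apply: measurable_funD => //; exact: mq.
have intq F : P.-integrable setT (EFin \o F) -> P.-integrable setT (EFin \o q F).
  by move=> /integrable_abse.
have intp F : P.-integrable setT (EFin \o F) -> P.-integrable setT (EFin \o p F).
  by move=> intF; have := integrableD measurableT (intq _ intF) intF; exact: eq_integrable.
have fin F : P.-integrable setT (EFin \o F) -> \int[P]_w (F w)%:E \is a fin_num.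
  by move=> intF; exact: integrable_fin_num intF.
have mul (G1 G2 : T -> R) : measurable_fun (setT : set (sigmaT D1)) G1 ->
    measurable_fun (setT : set (sigmaT D2)) G2 ->
    (forall w, 0 <= G1 w)%R -> (forall w, 0 <= G2 w)%R ->
    P.-integrable setT (EFin \o G1) -> P.-integrable setT (EFin \o G2) ->
    P.-integrable setT (fun w => (G1 w * G2 w)%:E).
  move=> mG1 mG2 G10 G20 intG1 intG2; apply/integrableP; split.
    apply/measurable_EFinP.
    by apply: measurable_funM; [exact: sigmaT_fun mG1|exact: sigmaT_fun mG2].
  under eq_integral do rewrite /= ger0_norm ?mulr_ge0//.
  rewrite (expectation_mul_indep D12)//.
  by rewrite ltey_eq fin_numM//; exact: fin.
have mq1 := mq _ _ mF1; have mq2 := mq _ _ mF2.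
have mp1 := mp _ _ mF1; have mp2 := mp _ _ mF2.
have iq1 := intq _ intF1; have iq2 := intq _ intF2.
have ip1 := intp _ intF1; have ip2 := intp _ intF2.
have Ep1 : \int[P]_w (p F1 w)%:E = \int[P]_w (q F1 w)%:E.
  rewrite -[RHS]adde0 -F10 -integralD//; exact: eq_integral.
have intA := integrableD measurableT (mul _ _ mp1 mp2 (p0 _) (p0 _) ip1 ip2)
  (mul _ _ mq1 mq2 (q0 _) (q0 _) iq1 iq2).
have intB := integrableD measurableT (mul _ _ mp1 mq2 (p0 _) (q0 _) ip1 iq2)
  (mul _ _ mq1 mp2 (q0 _) (p0 _) iq1 ip2).
(* F1 F2 = (p1 - q1) (p2 - q2) with nonnegative p_i and q_i, and E p1 = E q1. *)
have EAB : (fun w => (F1 w * F2 w)%:E) =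
    (fun w => ((p F1 w * p F2 w)%:E + (q F1 w * q F2 w)%:E) -
      ((p F1 w * q F2 w)%:E + (q F1 w * p F2 w)%:E)).
  apply/funext => w; rewrite -!EFinD; congr EFin.
  by rewrite /p /q; ring.
rewrite EAB; split; first exact: integrableB.
rewrite integralB//.
rewrite integralD//; [|exact: mul|exact: mul].
rewrite integralD//; [|exact: mul|exact: mul].
rewrite !(expectation_mul_indep D12)// Ep1 [X in X - _]addeC subee//.
by rewrite fin_numD !fin_numM//; exact: fin.
Qed.

(** The map [f] cuts the index set into disjoint blocks: [id] isolates single entries, [snd] groups
    a matrix by columns. *)
Lemma expectation_prod_indep (J : eqType) (s : seq J) (f : I -> J)
    (F : J -> T -> R) : uniq s ->
  (forall j, measurable_fun (setT : set (sigmaT [set i | f i == j]%SET)) (F j)) ->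
  (forall j w, 0 <= F j w)%R ->
  \int[P]_w (\prod_(j <- s) F j w)%:E = \prod_(j <- s) \int[P]_w (F j w)%:E.
Proof.
move=> + mF F0; elim: s => [|j s IHs] /=.
  move=> _; rewrite big_nil; under eq_integral do rewrite big_nil.
  by rewrite integral_cst// mul1e; exact: probability_setT.
move=> /andP[js us]; rewrite big_cons -IHs//.
under eq_integral do rewrite big_cons.
apply: (@expectation_mul_indep [set i | f i == j]%SET [set i | f i \in s]%SET) => //.
- rewrite -finset.setI_eq0; apply/eqP/finset.setP => i; rewrite !inE; apply/negbTE.
  by apply: contra js => /andP[/eqP <-].
- apply: measurable_prod => k ks; apply: sigmaT_fun_sub (mF k).
  by apply/fintype.subsetP => i; rewrite !inE => /eqP ->.
- by move=> w; apply: prodr_ge0.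
Qed.

End independence.

(** * Sub-gaussian moment generating functions *)

Section exponential_bounds.
Variable R : realType.
Implicit Types x y a s t : R.

(** For x <= 1/2, exp x <= 1/(1 - x) and (1 - x)(1 + x + 2 x^2) = 1 + x^2 (1 - 2 x) >= 1. For x >
    1/2 already x <= 2 x^2. *)
Lemma expR_le_add_sqr x : expR x <= x + expR (2 * x ^+ 2).
Proof.
have [x_le|x_gt] := leP x 2^-1; last first.
  apply: (@le_trans _ _ (expR (2 * x ^+ 2))); last by rewrite lerDr; lra.
  by rewrite ler_expR; nra.
have x1 : 0 < 1 - x by lra.
have h : expR x <= (1 - x)^-1.
  rewrite -[x]opprK expRN opprK lef_pV2 ?posrE ?expR_gt0//.
  by have := expR_ge1Dx (- x); lra.
have {}h : expR x <= 1 + x + 2 * x ^+ 2.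
  by apply: (le_trans h); rewrite -div1r ler_pdivrMr//; nra.
by have := expR_ge1Dx (2 * x ^+ 2); lra.
Qed.

(** Convexity between 0 and [y]: the tangent at t y lies below the graph at both ends, and the two
    inequalities are averaged. Under an expectation it reduces the exponent of exp(a z^2) without
    Jensen. *)
Lemma expR_interp t y : 0 <= t <= 1 -> expR (t * y) <= (1 - t) + t * expR y.
Proof.
move=> /andP[t0 t1].
have e1 : 1 = expR (t * y) * expR (- (t * y)) by rewrite -expRD subrr expR0.
have e2 : expR y = expR (t * y) * expR ((1 - t) * y) by rewrite -expRD; congr expR; ring.
have h1 : expR (t * y) * (1 - t * y) <= 1.
  by rewrite [leRHS]e1 ler_wpM2l ?expR_ge0//; have := expR_ge1Dx (- (t * y)); lra.
have h2 : expR (t * y) * (1 + (1 - t) * y) <= expR y.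
  by rewrite [leRHS]e2 ler_wpM2l ?expR_ge0// expR_ge1Dx.
have t1' : 0 <= 1 - t by lra.
have := ler_wpM2l t1' h1; have := ler_wpM2l t0 h2; lra.
Qed.

Lemma sqr_le_expR x : 0 <= x -> x ^+ 2 <= 4 * expR x.
Proof.
move=> x0; have -> : expR x = expR (x / 2) ^+ 2.
  by rewrite -expRM_natl; congr expR; field.
have -> : 4 * expR (x / 2) ^+ 2 = (2 * expR (x / 2)) ^+ 2 by ring.
rewrite ler_sqr ?nnegrE ?mulr_ge0 ?expR_ge0//.
by have := expR_ge1Dx (x / 2); lra.
Qed.

(** The linear term keeps its sign because centring will cancel it. With y = l x <= a x / 2, the
    remainder is at most y^2 exp(a x / 2), and (a x / 2)^2 <= 4 exp(a x / 2) absorbs the square. The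
    sign [b] serves the two tails. *)
Lemma expR_le_quadratic (x a l : R) (b : bool) :
  0 <= x -> 0 < a -> 0 <= l <= a / 2 ->
  expR ((-1) ^+ b * l * x) <=
    1 + (-1) ^+ b * l * x + 16 * (l / a) ^+ 2 * expR (a * x).
Proof.
move=> x0 a0 /andP[l0 la]; set y := l * x.
have y0 : 0 <= y by rewrite mulr_ge0.
have sq : (a * x / 2) ^+ 2 <= 4 * expR (a * x / 2).
  by apply: sqr_le_expR; rewrite divr_ge0// mulr_ge0// ltW.
have lax : 16 * (l / a) ^+ 2 * expR (a * x) =
    4 * (l / a) ^+ 2 * (4 * expR (a * x / 2)) * expR (a * x / 2).
  have -> : expR (a * x) = expR (a * x / 2) * expR (a * x / 2).
    by rewrite -expRD; congr expR; field.
  by ring.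
have yE : y ^+ 2 = 4 * (l / a) ^+ 2 * (a * x / 2) ^+ 2.
  by rewrite /y; field; rewrite gt_eqF.
have main : y ^+ 2 * expR (a * x / 2) <= 16 * (l / a) ^+ 2 * expR (a * x).
  have c0 : 0 <= 4 * (l / a) ^+ 2 by have := sqr_ge0 (l / a); lra.
  by rewrite lax yE ler_wpM2r ?expR_ge0// ler_wpM2l.
have ax2 : y <= a * x / 2 by rewrite /y mulrAC ler_wpM2r.
case: b => /=; rewrite ?expr1 ?expr0 ?mulN1r ?mul1r ?mulNr -/y; last first.
  have ey : expR y <= 1 + y * expR y.
    have := expR_ge1Dx (- y); rewrite expRN => /(ler_wpM2r (expR_ge0 y)).
    by rewrite mulVf ?gt_eqF ?expR_gt0//; lra.
  have ey2 : expR y <= 1 + y + y ^+ 2 * expR y.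
    by have := ler_wpM2l y0 ey; lra.
  apply: (le_trans ey2); rewrite lerD2l; apply: le_trans main.
  by rewrite ler_wpM2l ?sqr_ge0// ler_expR.
have y1 : 0 < 1 + y by lra.
have ey : expR (- y) <= 1 - y + y ^+ 2.
  rewrite expRN; apply: (@le_trans _ _ (1 + y)^-1).
    by rewrite lef_pV2 ?posrE ?expR_gt0// expR_ge1Dx.
  by rewrite -div1r ler_pdivrMr//; nra.
apply: (le_trans ey); rewrite lerD2l; apply: le_trans main.
rewrite ler_peMr ?sqr_ge0//; have := expR_ge1Dx (a * x / 2); lra.
Qed.

(** A single term of the exponential series at [m]; it does the work of Stirling's formula. *)
Lemma pow_le_fact_expR m : m%:R ^+ m <= m`!%:R * expR m%:R :> R.
Proof.
case: m => [|m]; first by rewrite expr0 fact0 expR0 mulr1.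
have := @expR_ge1Dxn R m.+1%:R m (ler0n _ _).
rewrite -ler_pdivrMl ?ltr0n ?fact_gt0// mulrC; lra.
Qed.

(** The inequality u <= exp(u - 1) at u = |x| / N, raised to the power [N]; of exp x and exp (- x),
    one is exp |x|. *)
Lemma pow_le_expR (N : nat) x : (0 < N)%N ->
  `|x| ^+ N <= N%:R ^+ N * expR (- N%:R) * (expR x + expR (- x)).
Proof.
move=> N0; have N0' : 0 < N%:R :> R by rewrite ltr0n.
have h : `|x| <= N%:R * expR (`|x| / N%:R - 1).
  have := expR_ge1Dx (`|x| / N%:R - 1).
  by rewrite addrC subrK ler_pdivrMr// mulrC.
apply: (@le_trans _ _ ((N%:R * expR (`|x| / N%:R - 1)) ^+ N)).
  by rewrite lerXn2r ?nnegrE ?mulr_ge0 ?expR_ge0.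
rewrite exprMn -mulrA ler_wpM2l ?exprn_ge0// -expRM_natl.
have -> : N%:R * (`|x| / N%:R - 1) = - N%:R + `|x| by field; rewrite gt_eqF.
rewrite expRD ler_wpM2l ?expR_ge0//.
have [x0|x0] := leP 0 x; first by rewrite ger0_norm// lerDl expR_ge0.
by rewrite ltr0_norm// lerDr expR_ge0.
Qed.

Lemma expR_nneseries x : 0 <= x ->
  (\sum_(0 <= m <oo) (x ^+ m / m`!%:R)%:E = (expR x)%:E)%E.
Proof.
move=> x0; apply/cvg_lim => //.
rewrite (_ : (fun n => _) = EFin \o series (exp_coeff x)).
  by apply: cvg_EFin; [exact: nearW|exact: is_cvg_series_exp_coeff].
by apply/funext => n; rewrite /= sumEFin.
Qed.

End exponential_bounds.

Section expectation_bounds.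
Context (d : measure_display) (T : measurableType d) (R : realType).
Variable P : probability T R.
Implicit Types f g h z : T -> R.
Local Open Scope ereal_scope.

Lemma integrable_le f (c : R) : measurable_fun setT f ->
  (forall w, 0 <= f w)%R -> \int[P]_w (f w)%:E <= c%:E ->
  P.-integrable setT (EFin \o f).
Proof.
move=> mf f0 fc; apply/integrableP; split; first exact/measurable_EFinP.
under eq_integral do rewrite /= ger0_norm//.
by rewrite (le_lt_trans fc)// ltry.
Qed.

Lemma le_integral_affine h f g (a b c : R) : measurable_fun setT h ->
  (forall w, 0 <= h w <= a + b * f w + c * g w)%R ->
  P.-integrable setT (EFin \o f) -> P.-integrable setT (EFin \o g) ->
  \int[P]_w (h w)%:E <=
    a%:E + b%:E * \int[P]_w (f w)%:E + c%:E * \int[P]_w (g w)%:E.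
Proof.
move=> mh hle intf intg.
have intb : P.-integrable setT (fun w => b%:E * (f w)%:E) by exact: integrableZl.
have intc : P.-integrable setT (fun w => c%:E * (g w)%:E) by exact: integrableZl.
have inta : P.-integrable setT (fun w => a%:E).
  by apply: finite_measure_integrable_cst.
have intab : P.-integrable setT (fun w => a%:E + b%:E * (f w)%:E).
  exact: integrableD.
have intr : P.-integrable setT (fun w => a%:E + b%:E * (f w)%:E + c%:E * (g w)%:E).
  exact: integrableD.
have <- : \int[P]_w (a%:E + b%:E * (f w)%:E + c%:E * (g w)%:E) =
    a%:E + b%:E * \int[P]_w (f w)%:E + c%:E * \int[P]_w (g w)%:E.
  rewrite integralD// integralD// integral_cst//.
  rewrite [X in _ * X + _ + _](_ : _ = 1) ?mule1; last exact: probability_setT.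
  by rewrite !integralZl.
apply: ge0_le_integral => //.
- by move=> w _; rewrite lee_fin; case/andP: (hle w).
- exact/measurable_EFinP.
- by case/integrableP: intr.
- by move=> w _; rewrite -!EFinM -!EFinD lee_fin; case/andP: (hle w).
Qed.

(** Integrate the exponential series term by term: the factorials cancel and the exponent 1/(2 D)
    leaves sum 2^-m = 2. *)
Lemma subgaussian_of_moments z (D : R) : (0 < D)%R -> measurable_fun setT z ->
  (forall m, \int[P]_w ((z w ^+ 2) ^+ m)%:E <= (m`!%:R * D ^+ m)%:E) ->
  \int[P]_w (expR ((2 * D)^-1 * z w ^+ 2))%:E <= 2%:E.
Proof.
move=> D0 mz zD.
have D20 : (0 <= (2 * D)^-1)%R by rewrite invr_ge0 mulr_ge0 ?ltW.
have mz2 m : measurable_fun setT (fun w => (z w ^+ 2) ^+ m)%R.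
  by apply: measurable_funX; exact: measurable_funX.
have zm_ge0 w m : (0 <= (z w ^+ 2) ^+ m)%R by apply: exprn_ge0; exact: sqr_ge0.
have cm_ge0 m : (0 <= (2 * D)^-1 ^+ m / m`!%:R)%R by rewrite divr_ge0// exprn_ge0.
under eq_integral => w _.
  rewrite -expR_nneseries; last by rewrite mulr_ge0// sqr_ge0.
  under eq_eseriesr => m _.
    rewrite exprMn mulrAC EFinM; over.
  over.
rewrite integral_nneseries//; last 2 first.
- by move=> m; apply: measurable_funeM; exact/measurable_EFinP.
- by move=> m w _; rewrite -EFinM lee_fin mulr_ge0.
have half : \sum_(0 <= m <oo) ((2^-1 : R) ^+ m)%:E = (2 : R)%:E.
  apply/cvg_lim => //.
  rewrite (_ : (fun n => _) = EFin \o series (geometric 1 (2^-1 : R))).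
    apply: cvg_EFin; first exact: nearW.
    have := @cvg_geometric_series R 1 2^-1.
    rewrite (_ : 1 * (1 - 2^-1)^-1 = 2)%R; last by field.
    by apply; rewrite ger0_norm; lra.
  by apply/funext => n; rewrite /= /series /= sumEFin; congr EFin;
    apply: eq_bigr => k _; rewrite /geometric /= mul1r.
rewrite -[leRHS]half; apply: lee_nneseries => m _.
  by move=> _; apply: integral_ge0 => w _; rewrite -EFinM lee_fin mulr_ge0.
rewrite ge0_integralZl//; last 3 first.
- exact/measurable_EFinP.
- by move=> w _; rewrite lee_fin.
- by rewrite lee_fin.
apply: (le_trans (lee_wpmul2l _ (zD m))); first by rewrite lee_fin.
rewrite -EFinM lee_fin !exprVn exprMn le_eqVlt; apply/orP; left; apply/eqP.
have f0 : (m`!%:R != 0 :> R)%R by rewrite pnatr_eq0 -lt0n fact_gt0.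
have d0 : (D ^+ m != 0)%R by rewrite expf_neq0// gt_eqF.
have t0 : (2 ^+ m != 0 :> R)%R by rewrite expf_neq0.
move: f0 d0 t0; move: (_ ^+ m)%R (_ ^+ m)%R (_%:R)%R => x y f f0 x0 y0.
by field; rewrite f0 x0 y0.
Qed.

(* For small s, use exp (s z) <= s z + exp (2 s^2 z^2), whose linear term has mean
   0; for large s, s z <= a z^2 / 2 + s^2 / (2 a). *)
Lemma mgf_of_subgaussian z (a s : R) : (0 < a)%R -> measurable_fun setT z ->
  P.-integrable setT (EFin \o z) -> \int[P]_w (z w)%:E = 0 ->
  \int[P]_w (expR (a * z w ^+ 2))%:E <= 2%:E ->
  \int[P]_w (expR (s * z w))%:E <= (expR (2 / a * s ^+ 2))%:E.
Proof.
move=> a0 mz intz z0 za.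
have mza : measurable_fun setT (fun w => expR (a * z w ^+ 2)).
  by apply: measurableT_comp => //; apply: measurable_funM => //; exact: measurable_funX.
have inta := integrable_le mza (fun w => expR_ge0 _) za.
have mzs : measurable_fun setT (fun w => expR (s * z w)).
  by apply: measurableT_comp => //; exact: measurable_funM.
set t := (2 / a * s ^+ 2)%R.
have t0 : (0 <= t)%R by rewrite mulr_ge0 ?sqr_ge0// divr_ge0// ltW.
have ts : (s ^+ 2 = t * a / 2)%R by rewrite /t; field; rewrite gt_eqF.
(* The target is exp t. For t <= 1 the bound obtained is 1 - t + 2 t = 1 + t; for t > 1 it is 3/2
   exp(t / 4), and exp(3 t / 4) >= 1 + 3 t / 4 > 3/2. *)
have [t1|t1] := leP t 1%R.
  apply: (@le_trans _ _ ((1 - t)%:E + s%:E * \int[P]_w (z w)%:E +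
      t%:E * \int[P]_w (expR (a * z w ^+ 2))%:E)).
    apply: le_integral_affine => // w; rewrite expR_ge0/=.
    have t01 : (0 <= t <= 1)%R by rewrite t0.
    have := expR_interp (a * z w ^+ 2) t01.
    have := expR_le_add_sqr (s * z w).
    have -> : (2 * (s * z w) ^+ 2 = t * (a * z w ^+ 2))%R.
      by rewrite exprMn ts; field.
    lra.
  rewrite z0 mule0 adde0; apply: (le_trans (leeD2l _ (lee_wpmul2l _ za))).
    by rewrite lee_fin.
  rewrite -EFinM -EFinD lee_fin; apply: le_trans (expR_ge1Dx t); lra.
apply: (@le_trans _ _ ((expR (t / 4) / 2)%:E + 0%:E * \int[P]_w (z w)%:E +
      (expR (t / 4) / 2)%:E * \int[P]_w (expR (a * z w ^+ 2))%:E)).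
  apply: le_integral_affine => // w; rewrite expR_ge0/= mul0r addr0.
  have -> : (expR (t / 4) / 2 + expR (t / 4) / 2 * expR (a * z w ^+ 2) =
      expR (t / 4) * ((1 - 2^-1) + 2^-1 * expR (a * z w ^+ 2)))%R by field.
  apply: (@le_trans _ _ (expR (t / 4) * expR (2^-1 * (a * z w ^+ 2)))%R).
    rewrite -expRD ler_expR -(ler_pM2l a0).
    have := sqr_ge0 (s - a * z w); rewrite sqrrB ts exprMn; lra.
  by rewrite ler_wpM2l ?expR_ge0// expR_interp//; lra.
rewrite mul0e adde0.
apply: (le_trans (leeD2l _ (lee_wpmul2l _ za))).
  by rewrite lee_fin divr_ge0// expR_ge0.
rewrite -EFinM -EFinD lee_fin.
have -> : expR t = (expR (t / 4) * expR (3 / 4 * t))%R.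
  by rewrite -expRD; congr expR; field.
have := expR_ge1Dx (3 / 4 * t)%R; have := expR_gt0 (t / 4)%R.
set e := expR (t / 4)%R => e0 h.
have : (e * (1 + 3 / 4 * t) <= e * expR (3 / 4 * t))%R by rewrite ler_wpM2l// ltW.
have : (e * 1 < e * t)%R by rewrite ltr_pM2l.
lra.
Qed.

Lemma integral_pow0 f : \int[P]_w (f w ^+ 0)%:E = 1.
Proof.
under eq_integral do rewrite expr0.
by rewrite integral_cst// mul1e; exact: probability_setT.
Qed.

(* |x|^N <= (N / e)^N (e^x + e^-x) at N = 2 m and x = s z, s = sqrt (m / b). *)
Lemma moments_of_mgf z (b : R) : (0 < b)%R -> measurable_fun setT z ->
  (forall s, \int[P]_w (expR (s * z w))%:E <= (expR (b * s ^+ 2))%:E) ->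
  forall m, \int[P]_w ((z w ^+ 2) ^+ m)%:E <= (m`!%:R * (8 * b) ^+ m)%:E.
Proof.
move=> b0 mz zb [|m]; first by rewrite integral_pow0 lee_fin fact0 expr0 mulr1.
set M : R := m.+1%:R; have M0 : (0 < M)%R by rewrite ltr0n.
set s := Num.sqrt (M / b); have s0 : (0 < s)%R by rewrite sqrtr_gt0 divr_gt0.
have s2 : (s ^+ 2 = M / b)%R by rewrite sqr_sqrtr// divr_ge0 ?ltW.
set N := (2 * m.+1)%N.
set c := ((s ^+ N)^-1 * (N%:R ^+ N * expR (- N%:R)))%R.
have c0 : (0 <= c)%R by rewrite mulr_ge0 ?mulr_ge0 ?expR_ge0// ?invr_ge0 exprn_ge0// ltW.
have mexp u : measurable_fun setT (fun w => expR (u * z w)).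
  by apply: measurableT_comp => //; exact: measurable_funM.
have bs : (b * s ^+ 2 = M)%R by rewrite s2; field; rewrite gt_eqF.
have zs := zb s; have zNs := zb (- s)%R; rewrite sqrrN bs in zs zNs.
apply: (@le_trans _ _ (0%:E + c%:E * \int[P]_w (expR (s * z w))%:E +
    c%:E * \int[P]_w (expR (- s * z w))%:E)).
  apply: le_integral_affine.
  - by apply: measurable_funX; exact: measurable_funX.
  - move=> w; rewrite exprn_ge0 ?sqr_ge0//= add0r -mulrDr.
    have -> : ((z w ^+ 2) ^+ m.+1 = `|z w| ^+ N)%R.
      by rewrite /N exprM real_normK ?num_real.
    have N0 : (0 < N)%N by [].
    have := pow_le_expR (s * z w) N0; rewrite normrM exprMn (gtr0_norm s0) => h.
    by rewrite /c -mulrA ler_pdivlMl ?exprn_gt0// mulNr.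
  - exact: integrable_le zs.
  - exact: integrable_le zNs.
rewrite add0e.
apply: (le_trans (leeD (lee_wpmul2l _ zs) (lee_wpmul2l _ zNs))); rewrite ?lee_fin//.
(* Of exp(-2 M), one factor exp(-M) cancels the Laplace transform, the other brings M^M below a
   factorial. The two exponentials leave a factor 2, absorbed into a power of 2: hence 8 b instead
   of 4 b. *)
have -> : (c = (4 * b) ^+ m.+1 * M ^+ m.+1 * expR (- N%:R))%R.
  rewrite /c mulrA /N !exprM s2 natrM -/M -exprVn -!exprMn; congr (_ ^+ _ * _)%R.
  by field; rewrite !gt_eqF.
have -> : expR (- N%:R) = ((expR M)^-1 * (expR M)^-1)%R :> R.
  by rewrite -!expRN -expRD /N natrM -/M; congr expR; ring.
have eM := expR_gt0 M.
have eM0 : (expR M != 0)%R by rewrite gt_eqF.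
have -> : ((4 * b) ^+ m.+1 * M ^+ m.+1 * ((expR M)^-1 * (expR M)^-1) * expR M +
  (4 * b) ^+ m.+1 * M ^+ m.+1 * ((expR M)^-1 * (expR M)^-1) * expR M =
  2 * ((4 * b) ^+ m.+1 * (M ^+ m.+1 / expR M)))%R.
  by move: (_ ^+ _)%R (_ ^+ _)%R => u v; field.
have -> : ((8 * b) ^+ m.+1 = 2 ^+ m.+1 * (4 * b) ^+ m.+1)%R.
  by rewrite -exprMn; congr (_ ^+ _)%R; ring.
have b40 : (0 <= 4 * b)%R by lra.
rewrite [X in (_ <= X)%R]mulrCA; apply: ler_pM => //.
- apply: mulr_ge0; first exact: exprn_ge0.
  by apply: divr_ge0; [apply: exprn_ge0; exact: ltW|exact: ltW].
- by rewrite -[X in (X <= _)%R]expr1 ler_eXn2l// ltr1n.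
rewrite mulrC; apply: ler_wpM2r; first exact: exprn_ge0.
by rewrite ler_pdivrMr//; exact: pow_le_fact_expR.
Qed.

(** Writing sl for the signed parameter, the quadratic bound integrates to 1 + sl mu + 32 (l/a)^2,
    with 32 = 16 * 2. This is at most the exponential of sl mu + 32 (l/a)^2, and the centring factor
    exp(- sl mu) removes the first-order term. *)
Lemma mgf_centered_sqr z (a mu l : R) (b : bool) : (0 < a)%R ->
  measurable_fun setT z -> \int[P]_w (z w ^+ 2)%:E = mu%:E ->
  \int[P]_w (expR (a * z w ^+ 2))%:E <= 2%:E -> (0 <= l <= a / 2)%R ->
  \int[P]_w (expR ((-1) ^+ b * l * (z w ^+ 2 - mu)))%:E <=
    (expR (32 * (l / a) ^+ 2))%:E.
Proof.
move=> a0 mz zmu za la.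
have mz2 : measurable_fun setT (fun w => z w ^+ 2)%R by exact: measurable_funX.
have mza : measurable_fun setT (fun w => expR (a * z w ^+ 2)).
  by apply: measurableT_comp => //; exact: measurable_funM.
set sl := ((-1) ^+ b * l)%R; set e := expR (- (sl * mu)).
have e0 : (0 < e)%R := expR_gt0 _.
apply: (@le_trans _ _ (e%:E + (e * sl)%:E * \int[P]_w (z w ^+ 2)%:E +
  (e * (16 * (l / a) ^+ 2))%:E * \int[P]_w (expR (a * z w ^+ 2))%:E)).
  apply: le_integral_affine.
  - apply: measurableT_comp => //; apply: measurable_funM => //.
    exact: measurable_funB.
  - move=> w; rewrite expR_ge0/=.
    have -> : (sl * (z w ^+ 2 - mu) = - (sl * mu) + sl * z w ^+ 2)%R by ring.
    have := expR_le_quadratic b (sqr_ge0 (z w)) a0 la.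
    rewrite -/sl expRD -/e -(ler_pM2l e0) => /le_trans -> //.
    by rewrite !mulrDr mulr1 !mulrA.
  - apply: (@integrable_le _ mu) => //; first by move=> w; exact: sqr_ge0.
    by rewrite zmu.
  - exact: integrable_le za.
rewrite zmu; apply: (le_trans (leeD2l _ (lee_wpmul2l _ za))).
  rewrite lee_fin; apply: mulr_ge0; first exact: ltW.
  by apply: mulr_ge0 => //; exact: sqr_ge0.
rewrite -!EFinM -!EFinD lee_fin.
have -> : expR (32 * (l / a) ^+ 2) = (e * expR (sl * mu + 32 * (l / a) ^+ 2))%R.
  by rewrite /e -expRD; congr expR; ring.
have := expR_ge1Dx (sl * mu + 32 * (l / a) ^+ 2)%R; rewrite -(ler_pM2l e0); lra.
Qed.

(** The supremum is tested at p = 2 (m + 1) only, where |z|^p is a power of z^2; the exponent 0 is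
    excluded by p >= 1. *)
Lemma psi2_moment z (K : R) m : measurable_fun setT z ->
  psi2_norm P z <= K%:E ->
  (0 <= K)%R /\
  \int[P]_w ((z w ^+ 2) ^+ m.+1)%:E <= ((K ^+ 2 * (2 * m.+1)%:R) ^+ m.+1)%:E.
Proof.
move=> mz zK; set p : R := (2 * m.+1)%:R.
have p1 : (1 <= p)%R by rewrite ler1n.
have p0 : (0 < p)%R by lra.
have Np : (Num.sqrt p)^-1%:E * 'N[P]_(p%:E)[EFin \o z] <= K%:E.
  by apply: le_trans zK; apply: ereal_sup_ubound; exists p.
have sp0 : (0 < Num.sqrt p)%R by rewrite sqrtr_gt0.
have K0 : (0 <= K)%R.
  rewrite -lee_fin; apply: le_trans Np; apply: mule_ge0; last exact: Lnorm_ge0.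
  by rewrite lee_fin invr_ge0 ltW.
split=> //.
have {}Np : 'N[P]_(p%:E)[EFin \o z] <= (Num.sqrt p * K)%:E.
  by rewrite EFinM -lee_pdivrMl.
have -> : \int[P]_w ((z w ^+ 2) ^+ m.+1)%:E = 'N[P]_(p%:E)[EFin \o z] `^ p.
  rewrite poweR_Lnorm ?gt_eqF//; apply: eq_integral => w _.
  by rewrite /= powR_mulrn// exprM real_normK ?num_real.
have -> : ((K ^+ 2 * p) ^+ m.+1)%:E = (Num.sqrt p * K)%:E `^ p.
  have sK0 : (0 <= Num.sqrt p * K)%R by rewrite mulr_ge0// ltW.
  rewrite poweR_EFin (@powR_mulrn _ _ (2 * m.+1))// exprM.
  by rewrite [(_ ^+ 2)%R in RHS]exprMn sqr_sqrtr ?ltW// mulrC.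
apply: (gt0_ler_poweR (ltW p0)) => //.
- by rewrite in_itv /= Lnorm_ge0 leey.
- by rewrite in_itv /= leey andbT lee_fin mulr_ge0// ltW.
Qed.

(** As m^m <= m! e^m, the moments (2 m K^2)^m are at most m! D^m with D = 2 e K^2, and the exponent
    is 1/(2 D). *)
Lemma subgaussian_of_psi2 z (K : R) : (0 < K)%R -> measurable_fun setT z ->
  psi2_norm P z <= K%:E ->
  \int[P]_w (expR ((4 * expR 1 * K ^+ 2)^-1 * z w ^+ 2))%:E <= 2%:E.
Proof.
move=> K0 mz zK.
have -> : (4 * expR 1 * K ^+ 2 = 2 * (2 * expR 1 * K ^+ 2))%R by ring.
apply: subgaussian_of_moments => //.
  by rewrite !mulr_gt0 ?expR_gt0.
move=> [|m]; first by rewrite integral_pow0 lee_fin fact0 expr0 mulr1.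
have [_ /le_trans] := psi2_moment m mz zK; apply.
rewrite lee_fin natrM.
have -> : (K ^+ 2 * (2 * m.+1%:R) = m.+1%:R * (2 * K ^+ 2))%R by ring.
have -> : (2 * expR 1 * K ^+ 2 = expR 1 * (2 * K ^+ 2))%R by ring.
have y0 : (0 <= (2 * K ^+ 2) ^+ m.+1)%R.
  by apply: exprn_ge0; apply: mulr_ge0 => //; exact: sqr_ge0.
move: (2 * K ^+ 2)%R y0 => y y0; rewrite !exprMn mulrA ler_wpM2r//.
by have := @pow_le_fact_expR R m.+1; rewrite -[in expR _](mulr1 m.+1%:R) expRM_natl.
Qed.

End expectation_bounds.

Lemma lee_prod_fin (R : realType) (I : Type) (s : seq I) (f : I -> \bar R)
    (g : I -> R) : (forall i, 0 <= f i <= (g i)%:E)%E ->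
  (\prod_(i <- s) f i <= (\prod_(i <- s) g i)%:E)%E.
Proof.
move=> fg; elim: s => [|i s IHs]; first by rewrite !big_nil.
rewrite !big_cons EFinM; have /andP[f0 fle] := fg i.
by apply: lee_pmul => //; apply: prode_ge0 => k _; case/andP: (fg k).
Qed.

(** * Concentration of quadratic forms *)

Section concentration.
Context (disp : measure_display) (T : measurableType disp) (R : realType).
Context (P : probability T R) (n d : nat) (z : 'I_n * 'I_d -> T -> R) (a : R).
Hypothesis a_gt0 : 0 < a.
Hypothesis mz : forall p, measurable_fun setT (z p).
Hypothesis indz : mutually_independent P z.
Hypothesis intz : forall p, P.-integrable setT (EFin \o z p).
Hypothesis mean0 : forall p, (\int[P]_w (z p w)%:E = 0)%E.
Hypothesis var1 : forall p, (\int[P]_w (z p w ^+ 2)%:E = 1)%E.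
Hypothesis subg : forall p, (\int[P]_w (expR (a * z p w ^+ 2))%:E <= 2%:E)%E.

Definition colcomb (v : 'rV[R]_n) (j : 'I_d) (w : T) : R :=
  \sum_i v 0 i * z (i, j) w.

Lemma measurable_colcomb v j : measurable_fun setT (colcomb v j).
Proof. by apply: measurable_sum => i; exact: measurable_funM. Qed.

Lemma colcomb_sigmaT v j : measurable_fun
  (setT : set (sigmaT z [set p : 'I_n * 'I_d | p.2 == j]%SET)) (colcomb v j).
Proof.
apply: measurable_sum => i; apply: measurable_funM => //.
by apply: sigmaT_coord; rewrite inE.
Qed.

Local Open Scope ereal_scope.

Lemma cross_moment i k j :
  P.-integrable setT (fun w => (z (i, j) w * z (k, j) w)%:E) /\
  \int[P]_w (z (i, j) w * z (k, j) w)%:E = (i == k)%:R%:E.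
Proof.
have [<-|ik] := eqVneq i k.
  under eq_integral do rewrite -expr2.
  rewrite var1; split=> //.
  under eq_fun do rewrite -expr2.
  apply: (@integrable_le _ _ _ _ _ 1); last by rewrite var1.
    exact: measurable_funX.
  by move=> w; exact: sqr_ge0.
apply: (@expectation_mul_indep0 _ _ _ _ _ _ _ z mz indz
  [set (i, j)]%SET [set (k, j)]%SET) => //.
- by rewrite disjoints1 inE xpair_eqE (negPf ik).
- by apply: sigmaT_coord; rewrite inE.
- by apply: sigmaT_coord; rewrite inE.
Qed.

Lemma colcomb_var v j : \int[P]_w (colcomb v j w ^+ 2)%:E = (rdot v v)%:E.
Proof.
have int i k : P.-integrable setT
    (fun w => (v 0%R i * v 0%R k)%:E * (z (i, j) w * z (k, j) w)%:E).
  by apply: integrableZl => //; case: (cross_moment i k j).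
transitivity (\int[P]_w (\sum_i \sum_k
    (v 0%R i * v 0%R k)%:E * (z (i, j) w * z (k, j) w)%:E)).
  apply: eq_integral => w _.
  rewrite /colcomb expr2 mulr_suml -sumEFin; apply: eq_bigr => i _.
  rewrite mulr_sumr -sumEFin; apply: eq_bigr => k _.
  by rewrite -EFinM; congr EFin; ring.
rewrite integral_sum//; last by move=> i; exact: integrable_sum.
rewrite rdot_sqr -sumEFin; apply: eq_bigr => i _.
rewrite integral_sum// (bigD1 i)//= big1 ?adde0 => [|k ki].
  have [ii eii] := cross_moment i i j.
  by rewrite integralZl// eii eqxx mule1 expr2.
have [ik eik] := cross_moment i k j.
by rewrite integralZl// eik eq_sym (negPf ki) mule0.
Qed.

(** Exponents add up over independent entries: the i-th contributes (s v_i)^2, in total s^2 |v|^2 <=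
    s^2, so no factor depends on [n]. *)
Lemma colcomb_mgf v j s : (rdot v v <= 1)%R ->
  \int[P]_w (expR (s * colcomb v j w))%:E <= (expR (2 / a * s ^+ 2))%:E.
Proof.
move=> v1; pose F p w := expR (s * v 0%R p.1 * z p w).
pose ps := [seq (i, j) | i <- enum 'I_n].
have -> : \int[P]_w (expR (s * colcomb v j w))%:E =
    \int[P]_w (\prod_(p <- ps) F p w)%:E.
  apply: eq_integral => w _; congr EFin.
  rewrite big_map big_enum /= -expR_sum /colcomb mulr_sumr.
  by congr expR; apply: eq_bigr => i _; rewrite mulrA.
rewrite (@expectation_prod_indep _ _ _ _ _ _ _ z mz indz _ _ id)//.
- apply: (@le_trans _ _ (\prod_(p <- ps) expR (2 / a * (s * v 0 p.1) ^+ 2))%R%:E).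
    apply: lee_prod_fin => p; apply/andP; split.
      by apply: integral_ge0 => w _; rewrite lee_fin expR_ge0.
    exact: mgf_of_subgaussian.
  rewrite lee_fin big_map big_enum /= -expR_sum ler_expR.
  have -> : (\sum_i 2 / a * (s * v 0 i) ^+ 2 = 2 / a * s ^+ 2 * rdot v v)%R.
    by rewrite rdot_sqr mulr_sumr; apply: eq_bigr => i _; rewrite exprMn; ring.
  rewrite ler_piMr//; apply: mulr_ge0; last exact: sqr_ge0.
  by apply: divr_ge0 => //; exact: ltW.
- by rewrite map_inj_uniq ?enum_uniq// => i k [].
- move=> p; apply: measurableT_comp => //; apply: measurable_funM => //.
  by apply: sigmaT_coord; rewrite inE.
- by move=> p w; exact: expR_ge0.
Qed.

(** The price of the round trip: exponent 2/a for the Laplace transform, 8 (2/a) = 16/a for the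
    moments, 1/(2 (16/a)) = a/32 at the end. *)
Lemma colcomb_subgaussian v j : (rdot v v <= 1)%R ->
  \int[P]_w (expR (a / 32 * colcomb v j w ^+ 2))%:E <= 2%:E.
Proof.
move=> v1; have b0 : (0 < 2 / a)%R by rewrite divr_gt0.
have -> : (a / 32 = (2 * (8 * (2 / a)))^-1)%R by field; rewrite gt_eqF.
apply: subgaussian_of_moments; first by rewrite mulr_gt0.
  exact: measurable_colcomb.
apply: moments_of_mgf => //; first exact: measurable_colcomb.
by move=> s; exact: colcomb_mgf.
Qed.

Definition dev v w : R := \sum_j (colcomb v j w ^+ 2 - rdot v v).

Lemma measurable_dev v : measurable_fun setT (dev v).
Proof.
apply: measurable_sum => j; apply: measurable_funB => //.
by apply: measurable_funX; exact: measurable_colcomb.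
Qed.

(** One centred square per column, and [d] independent columns multiply. The range of [l] is half of
    the exponent a/32 available for a column. *)
Lemma dev_mgf v l (b : bool) : (rdot v v <= 1)%R -> (0 <= l <= a / 64)%R ->
  \int[P]_w (expR ((-1) ^+ b * l * dev v w))%:E <=
  (expR (d%:R * (32 * (32 * l / a) ^+ 2)))%:E.
Proof.
move=> v1 /andP[l0 la].
pose F j w := expR ((-1) ^+ b * l * (colcomb v j w ^+ 2 - rdot v v)).
have -> : \int[P]_w (expR ((-1) ^+ b * l * dev v w))%:E =
    \int[P]_w (\prod_(j <- enum 'I_d) F j w)%:E.
  apply: eq_integral => w _; congr EFin.
  by rewrite big_enum /= -expR_sum /dev mulr_sumr.
rewrite (@expectation_prod_indep _ _ _ _ _ _ _ z mz indz _ _ snd)//.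
- apply: (@le_trans _ _ (\prod_(j <- enum 'I_d) expR (32 * (32 * l / a) ^+ 2))%R%:E).
    apply: lee_prod_fin => j; apply/andP; split.
      by apply: integral_ge0 => w _; rewrite lee_fin expR_ge0.
    have -> : (32 * l / a = l / (a / 32))%R by field; rewrite gt_eqF.
    apply: mgf_centered_sqr.
    + by rewrite divr_gt0.
    + exact: measurable_colcomb.
    + exact: colcomb_var.
    + exact: colcomb_subgaussian.
    + by rewrite l0/=; lra.
  by rewrite lee_fin big_enum /= prodr_const card_ord -expRM_natl.
- exact: enum_uniq.
- move=> j; apply: measurableT_comp => //; apply: measurable_funM => //.
  by apply: measurable_funB => //; apply: measurable_funX; exact: colcomb_sigmaT.
- by move=> j w; exact: expR_ge0.
Qed.

Lemma dev_tail v l u : (rdot v v <= 1)%R -> (0 < l <= a / 64)%R ->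
  P [set w | (u <= `|dev v w|)%R] <=
  (2 * expR (d%:R * (32 * (32 * l / a) ^+ 2) - l * u))%:E.
Proof.
move=> v1 /andP[l0 la].
have ms (b : bool) : measurable_fun setT (fun w => (-1) ^+ b * dev v w)%R.
  by apply: measurable_funM => //; exact: measurable_dev.
pose X (b : bool) : {RV P >-> R} :=
  HB.pack (fun w => (-1) ^+ b * dev v w)%R (isMeasurableFun.Build _ _ _ _ _ (ms b)).
have mX b : measurable [set w | (X b w >= u)%R].
  rewrite -[X in measurable X]setTI.
  have -> : [set w | (u <= X b w)%R] = X b @^-1` `[u, +oo[.
    by apply/seteqP; split => w /=; rewrite in_itv /= andbT.
  by have := ms b measurableT _ (measurable_itv `[u, +oo[); exact.
have tail b : P [set w | (X b w >= u)%R] <=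
    (expR (d%:R * (32 * (32 * l / a) ^+ 2) - l * u))%:E.
  apply: (le_trans (chernoff _ _ l0)).
  rewrite /mmt_gen_fun expRD EFinM.
  apply: lee_wpmul2r; first by rewrite lee_fin expR_ge0.
  rewrite unlock; apply: le_trans (@dev_mgf v l b v1 _); last by rewrite ltW.
  rewrite le_eqVlt; apply/orP; left; apply/eqP; apply: eq_integral => w _.
  by rewrite /=; congr (expR _)%:E; ring.
have -> : [set w | (u <= `|dev v w|)%R] =
    [set w | (X false w >= u)%R] `|` [set w | (X true w >= u)%R].
  apply/seteqP; split => w /=; rewrite expr0 expr1 mul1r mulN1r.
    have [d0|d0] := leP 0%R (dev v w).
      by rewrite ger0_norm//; left.
    by rewrite ltr0_norm//; right.
  by rewrite ler_normr => -[->|->]//; rewrite orbT.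
apply: (le_trans (measureU2 _ _ _)) => //.
rewrite mulr_natl mulr2n EFinD; apply: leeD; exact: tail.
Qed.

Lemma dev_union l u : (0 < l <= a / 64)%R ->
  let bad := [set w | exists f,
    (f \in net n) && (u <= `|dev (net_point R f) w|)%R] in
  measurable bad /\ P bad <=
  (2 ^+ (18 * n) * (2 * expR (d%:R * (32 * (32 * l / a) ^+ 2) - l * u)))%:E.
Proof.
move=> la bad.
set c := (2 * expR _)%R; have c0 : (0 <= c)%R by rewrite mulr_ge0 ?expR_ge0.
pose A f := [set w | (u <= `|dev (net_point R f) w|)%R].
have mA f : measurable (A f).
  rewrite -[X in measurable X]setTI.
  have -> : A f = (fun w => `|dev (net_point R f) w|%R) @^-1` `[u, +oo[.
    by apply/seteqP; split => w /=; rewrite in_itv /= andbT.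
  have mf : measurable_fun setT (fun w => `|dev (net_point R f) w|%R).
    by apply: measurableT_comp => //; exact: measurable_dev.
  exact: mf.
have union (s : seq {ffun 'I_n -> bool * 'I_(16 * n).+1}) :
    {subset s <= net n} ->
    P (\big[setU/set0]_(f <- s) A f) <= ((size s)%:R * c)%:E.
  elim: s => [|f s IHs] sub; first by rewrite big_nil measure0 mul0r.
  rewrite big_cons; apply: (le_trans (measureU2 _ _ _)) => //.
    exact: bigsetU_measurable.
  rewrite /= -natr1 mulrDl mul1r addrC EFinD; apply: leeD.
    by apply: IHs => g gs; apply: sub; rewrite inE gs orbT.
  by apply: dev_tail => //; apply: net_le1; apply: sub; rewrite mem_head.
have -> : bad =
    \big[setU/set0]_(f <- enum (net n)) A f.
  rewrite -bigcup_seq; apply/seteqP; split => w /=.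
    by move=> [f /andP[fn fu]]; exists f => //=; rewrite mem_enum.
  by move=> [f /=]; rewrite mem_enum => fn fu; exists f; rewrite fn.
split; first exact: bigsetU_measurable.
apply: (le_trans (union _ _)) => [f|]; first by rewrite mem_enum.
rewrite lee_fin ler_wpM2r// -cardE -natrX ler_nat; exact: card_net.
Qed.

End concentration.

(** * From quadratic forms to eigenvalues *)

Section sandwich.
Variable R : realType.

Lemma quadZ n (k : R) (M : 'M[R]_n) (u : 'rV[R]_n) :
  quad (k *: M) u = k * quad M u.
Proof. by rewrite !quadE -scalemxAr rdotZl. Qed.

Lemma lambdaZ n (k : R) (M : 'M[R]_n) (i : nat) : 0 < k -> M^T = M ->
  (1 <= i <= n)%N -> lambda i (k *: M) = k * lambda i M.
Proof.
move=> k0 symM i1n; have symkM : (k *: M)^T = k *: M by rewrite linearZ/= symM.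
apply/le_anti/andP; split.
  rewrite -[leRHS]addr0; apply: le_lambda_shift => // u.
  by rewrite quadZ mul0r addr0.
rewrite -ler_pdivlMl// -[leRHS]addr0; apply: le_lambda_shift => //.
  by rewrite invr_gt0.
by move=> u; rewrite quadZ mulKf ?gt_eqF// mul0r addr0.
Qed.

Lemma lambda_gram_sandwich n d (S : 'M[R]_d) (Z : 'M[R]_(n, d)) (i : nat)
    (delta : R) :
  S^T = S -> S \in unitmx -> (n <= d)%N -> (1 <= i <= n)%N -> 0 <= delta ->
  (forall v : 'rV[R]_n,
     `|rdot (v *m Z) (v *m Z) - d%:R * rdot v v| <= d%:R * delta * rdot v v) ->
  lambda (i + d - n) (S *m S) * (1 - delta) <=
    n%:R / d%:R * lambda i (n%:R^-1 *: ((Z *m S)^T *m (Z *m S))) <=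
  lambda i (S *m S) * (1 + delta).
Proof.
move=> symS unitS nd i1n delta0 Zd.
have i1d : (1 <= i <= d)%N by lia.
have n0 : 0 < n%:R :> R by rewrite ltr0n; lia.
have d0 : 0 < d%:R :> R by rewrite ltr0n; lia.
have -> : (Z *m S)^T *m (Z *m S) = S *m Z^T *m (S *m Z^T)^T.
  by rewrite !trmx_mul trmxK symS !mulmxA.
rewrite lambdaZ ?invr_gt0//; last by rewrite trmx_mul trmxK.
set G := S *m Z^T *m (S *m Z^T)^T.
have -> : n%:R / d%:R * (n%:R^-1 * lambda i G) = lambda i G / d%:R.
  by field; rewrite !gt_eqF.
apply/andP; split; last first.
  rewrite ler_pdivrMr// -mulrA mulrC; apply: lambda_gram_le => //.
    by rewrite mulr_gt0//; lra.
  by move=> v; have := Zd v; rewrite ler_norml => /andP[_]; lra.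
rewrite ler_pdivlMr// -mulrA mulrC.
(* The min-max argument needs d (1 - delta) > 0. Otherwise the lower bound is nonpositive, while a
   Gram matrix has nonnegative eigenvalues. *)
have [delta1|delta1] := ltP delta 1.
  apply: lambda_gram_ge => //; first by rewrite mulr_gt0//; lra.
  by move=> v; have := Zd v; rewrite ler_norml => /andP[+ _]; lra.
apply: (@le_trans _ _ 0); last exact: lambda_psd_ge0.
rewrite mulr_le0_ge0//; first by rewrite mulr_le0_ge0//; lra.
by rewrite -{2}symS; apply: lambda_psd_ge0; lia.
Qed.

Lemma le2_expR1 : 2 <= expR 1 :> R.
Proof. by have := expR_ge1Dx (1 : R); lra. Qed.

Lemma min_max_sqr (x : R) : 0 < x -> Num.min 1 x * Num.max x (x ^+ 2) = x ^+ 2.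
Proof.
move=> x0; have [x1|x1] := leP 1 x.
  by rewrite mul1r max_r// expr2 ler_peMl// ltW.
by rewrite max_l ?expr2// ler_piMl// ltW.
Qed.

(* With a K^2 = 1 / (4 e), C = 24^3 e gives l u = 27 d eps^2, against at most
   8 d eps^2 from the Laplace transform and 18 n from the net, while
   n + t^2 <= d eps^2. *)
Lemma tail_exponent (n d : nat) (K t : R) : (0 < n)%N -> (0 < d)%N ->
  0 < K -> 0 <= t ->
  let eps := Num.sqrt (n%:R / d%:R) + t / Num.sqrt d%:R in
  let delta := 24 ^+ 3 * expR 1 * K ^+ 2 * Num.max eps (eps ^+ 2) in
  let a := (4 * expR 1 * K ^+ 2)^-1 in
  let l := a / 64 * Num.min 1 eps in
  [/\ 0 < a, 0 <= delta, 0 < l <= a / 64 &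
  2 ^+ (18 * n) * (2 * expR (d%:R * (32 * (32 * l / a) ^+ 2)
    - l * (d%:R * delta / 2))) <= 2 * expR (- t ^+ 2)].
Proof.
move=> n0 d0 K0 t0 eps delta a l.
have e0 := @expR_gt0 R 1.
have dR0 : 0 < d%:R :> R by rewrite ltr0n.
have nR0 : 0 < n%:R :> R by rewrite ltr0n.
have sd0 : 0 < Num.sqrt d%:R :> R by rewrite sqrtr_gt0.
have eps0 : 0 < eps.
  by apply: ltr_wpDr; [exact: divr_ge0 (ltW sd0)|rewrite sqrtr_gt0 divr_gt0].
have K20 : 0 < K ^+ 2 by rewrite exprn_gt0.
have a0 : 0 < a by rewrite invr_gt0 !mulr_gt0.
have mu0 : 0 < Num.min 1 eps by rewrite lt_min ltr01.
have mu1 : Num.min 1 eps <= 1 by rewrite ge_min lexx.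
have mx0 : 0 < Num.max eps (eps ^+ 2) by rewrite lt_max eps0.
have deps : n%:R + t ^+ 2 <= d%:R * eps ^+ 2.
  have -> : d%:R * eps ^+ 2 = (Num.sqrt n%:R + t) ^+ 2.
    rewrite -[X in X * _](@sqr_sqrtr _ d%:R)// -exprMn /eps sqrtrM// sqrtrV//.
    by congr (_ ^+ 2); field; rewrite gt_eqF.
  rewrite sqrrD sqr_sqrtr// lerD2r lerDl.
  by rewrite mulrn_wge0// mulr_ge0// sqrtr_ge0.
split=> //.
- apply: mulr_ge0; last exact: ltW.
  apply: mulr_ge0; last exact: ltW.
  by apply: mulr_ge0; [exact: exprn_ge0|exact: ltW].
- by rewrite /l mulr_gt0 ?divr_gt0//= ler_piMr// divr_ge0// ltW.
have -> : 32 * l / a = Num.min 1 eps / 2 by rewrite /l; field; rewrite gt_eqF.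
(* Here 24^3 = 512 * 27, and 512 collects 64 from [l], 4 from [a] and the 2 by which [delta] is
   halved on the net. *)
have -> : l * (d%:R * delta / 2) =
    27 * d%:R * (Num.min 1 eps * Num.max eps (eps ^+ 2)).
  by rewrite /l /delta /a; field; rewrite !gt_eqF.
rewrite min_max_sqr//.
have mu2 : Num.min 1 eps ^+ 2 <= eps ^+ 2.
  by rewrite ler_sqr ?nnegrE ?(ltW mu0) ?(ltW eps0)// ge_min lexx orbT.
have dmu2 : d%:R * Num.min 1 eps ^+ 2 <= d%:R * eps ^+ 2 by rewrite ler_wpM2l// ltW.
rewrite mulrCA ler_pM2l//.
apply: (@le_trans _ _ (expR (18 * n%:R) *
    expR (d%:R * (32 * (Num.min 1 eps / 2) ^+ 2) - 27 * d%:R * eps ^+ 2))).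
  rewrite ler_wpM2r ?expR_ge0// -natrM -[(18 * n)%:R]mulr1 expRM_natl.
  by rewrite lerXn2r ?nnegrE ?expR_ge0// le2_expR1.
rewrite -expRD ler_expR.
have -> : d%:R * (32 * (Num.min 1 eps / 2) ^+ 2) = 8 * (d%:R * Num.min 1 eps ^+ 2).
  by field.
have t20 := sqr_ge0 t.
rewrite -(mulrA 27); move: dmu2 deps t20 nR0.
move: (d%:R * _) (d%:R * _) (t ^+ 2) (n%:R : R) => p q r m; clear; lra.
Qed.

End sandwich.

(** * Whitened rows: integrability, moments, and factorisation through the square root of the
    covariance *)

Section random_matrix.
Context (disp : measure_display) (T : measurableType disp) (R : realType).
Context (P : probability T R).
Local Open Scope ereal_scope.

(** The integral is the difference of those of the positive and negative parts, and oo - oo is -oo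
    by convention: the value 0 forces both to be finite. *)
Lemma integrable_of_mean0 (f : T -> R) : measurable_fun setT f ->
  \int[P]_w (f w)%:E = 0 -> P.-integrable setT (EFin \o f).
Proof.
move=> mf; rewrite integralE => f0.
have mfE : measurable_fun setT (EFin \o f) by exact/measurable_EFinP.
apply/integrableP; split=> //.
under eq_integral do rewrite -/((abse \o (EFin \o f)) _) fune_abse.
rewrite ge0_integralD//; last 2 first.
  exact: measurable_funepos.
  exact: measurable_funeneg.
have : 0 <= \int[P]_w (EFin \o f)^\+ w by exact: integral_ge0.
have : 0 <= \int[P]_w (EFin \o f)^\- w by exact: integral_ge0.
move: f0; rewrite /comp.
by case: (integral _ _ _) => [p| |]; case: (integral _ _ _) => [q| |]//= _ _ _; rewrite ltry.
Qed.

Lemma second_moment (f : T -> R) : \int[P]_w (f w)%:E = 0 ->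
  variance P f = 1 -> \int[P]_w (f w ^+ 2)%:E = 1.
Proof.
move=> f0; rewrite /variance unlock => <-; rewrite unlock f0.
by apply: eq_integral => w _; rewrite !fctE /= subr0 expr2.
Qed.

(** With K = 0 the second moment would vanish. Positivity is required because the exponent of
    [subgaussian_of_psi2] inverts K^2. *)
Lemma psi2_bound_gt0 (f : T -> R) (K : R) : measurable_fun setT f ->
  \int[P]_w (f w ^+ 2)%:E = 1 -> psi2_norm P f <= K%:E -> (0 < K)%R.
Proof.
move=> mf f1 fK; have [K0] := psi2_moment 0 mf fK.
rewrite lt_neqAle K0 andbT; apply: contraTneq => <-.
under eq_integral do rewrite expr1.
by rewrite f1 -ltNge lte_fin expr1 expr0n /= mul0r ltr01.
Qed.

Context (n d : nat) (x : 'I_n -> {RV P >-> d.-tuple R}).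

Definition whitened_mx (w : T) : 'M[R]_(n, d) :=
  (\matrix_(i, j) whitened x i w j 0)%R.

Lemma measurable_entry i j : measurable_fun setT (fun w => tnth (x i w) j).
Proof. exact: (measurableT_comp (measurable_tnth j)). Qed.

Lemma whitenedE i j w : whitened x i w j 0%R =
  (\sum_k invmx (sqrtmx (covmx x)) j k * tnth (x i w) k)%R.
Proof. by rewrite mxE; apply: eq_bigr => k _; rewrite !mxE. Qed.

Lemma measurable_whitened i j : measurable_fun setT (fun w => whitened x i w j 0%R).
Proof.
under eq_fun do rewrite whitenedE.
by apply: measurable_sum => k; apply: measurable_funM => //; exact: measurable_entry.
Qed.

Lemma whitened_mean0 : (forall i j, \int[P]_w (tnth (x i w) j)%:E = 0) ->
  forall i j, \int[P]_w (whitened x i w j 0%R)%:E = 0.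
Proof.
move=> x0 i j.
have intx k : P.-integrable setT (fun w => (tnth (x i w) k)%:E).
  exact: integrable_of_mean0 (measurable_entry i k) (x0 i k).
under eq_integral do rewrite whitenedE -sumEFin.
rewrite integral_sum//; last first.
  by move=> k; under eq_fun do rewrite EFinM; exact: integrableZl.
rewrite big1// => k _; under eq_integral do rewrite EFinM.
by rewrite integralZl// x0 mule0.
Qed.

(* [sqrtmx] is 0 on a matrix without square root, and [invmx 0 = 0]: the whitened
   vectors would then vanish, contradicting the variance. *)
Lemma covmx_sqrt i j : variance P (fun w => whitened x i w j 0%R) = 1 ->
  covmx x \in unitmx ->
  [/\ psdmx (sqrtmx (covmx x)), (sqrtmx (covmx x) *m sqrtmx (covmx x) = covmx x)%R &
      sqrtmx (covmx x) \in unitmx].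
Proof.
move=> v1 unit_cov.
have [S0|S0] := eqVneq (sqrtmx (covmx x)) 0%R.
  have inv0 : invmx (0 : 'M[R]_d)%R = 0%R.
    apply: invmx_out; apply/negP => /mulmxV; rewrite mul0mx.
    move=> /matrixP/(_ j j)/eqP; rewrite !mxE eqxx eq_sym; exact/negP/oner_neq0.
  have z0 w : whitened x i w j 0%R = 0%R.
    by rewrite whitenedE S0 inv0 big1// => k _; rewrite mxE mul0r.
  move: v1; under eq_fun do rewrite z0.
  rewrite variance_cst => /eqP; by rewrite eq_sym onee_eq0.
have [[S SP]|noS] := pselect (exists S, psdmx S /\ (S *m S = covmx x)%R); last first.
  move: S0; rewrite /sqrtmx xgetPN ?eqxx// => S SP; apply: noS; by exists S.
have SE : sqrtmx (covmx x) = S by case: SP; exact: sqrtmx_eq.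
rewrite SE; case: SP => psdS SS; split=> //.
by move: unit_cov; rewrite -SS unitmx_mul => /andP[].
Qed.

Lemma rowsmx_whitened w : sqrtmx (covmx x) \in unitmx ->
  ((sqrtmx (covmx x))^T = sqrtmx (covmx x) ->
   rowsmx x w = whitened_mx w *m sqrtmx (covmx x))%R.
Proof.
move=> unitS symS; apply/row_matrixP => i; rewrite row_mul.
have -> : row i (whitened_mx w) = ((whitened x i w)^T)%R.
  by apply/rowP => j; rewrite !mxE; apply: eq_bigr => k _; rewrite !mxE.
rewrite /whitened trmx_mul trmxK trmx_inv symS mulmxKV//.
Qed.

End random_matrix.

(** * Measurability of the event of the theorem *)

Section event.
Context (disp : measure_display) (T : measurableType disp) (R : realType).
Context (P : probability T R) (n d : nat) (x : 'I_n -> {RV P >-> d.-tuple R}).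

Lemma sample_cov_sym w : (sample_cov x w)^T = sample_cov x w.
Proof. by rewrite /sample_cov linearZ /= trmx_mul trmxK. Qed.

Lemma measurable_sample_cov j k :
  measurable_fun setT (fun w => sample_cov x w j k).
Proof.
rewrite (_ : (fun w => _) = fun w =>
    n%:R^-1 * \sum_i tnth (x i w) j * tnth (x i w) k); last first.
  by apply/funext => w; rewrite !mxE; congr (_ * _); apply: eq_bigr => i _; rewrite !mxE.
apply: measurable_funM => //; apply: measurable_sum => i.
by apply: measurable_funM; exact: measurable_entry.
Qed.

Lemma measurable_lambda_event (lo hi : nat -> R) (c : R) : (n <= d)%N ->
  measurable [set w | forall i : nat, (1 <= i <= n)%N ->
    (lo i <= c * lambda i (sample_cov x w) <= hi i)%R].
Proof.
move=> nd.
pose A i := [set w | (1 <= i <= n)%N ->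
  (lo i <= c * lambda i (sample_cov x w) <= hi i)%R].
rewrite (_ : [set w | _] = \bigcap_i A i); last first.
  by apply/seteqP; split => w Aw i => [_|]; apply: Aw.
apply: bigcap_measurableType => i _; rewrite /A.
have [i1n|i1n] := boolP (1 <= i <= n)%N; last first.
  by rewrite (_ : [set w | _] = setT)//; apply/seteqP; split.
have ml : measurable_fun setT (fun w => c * lambda i (sample_cov x w)).
  apply: measurable_funM => //; apply: measurable_lambda.
  - by case/andP: i1n => -> /leq_trans ->.
  - exact: sample_cov_sym.
  - exact: measurable_sample_cov.
rewrite (_ : [set w | _] =
    (fun w => c * lambda i (sample_cov x w)) @^-1` `[lo i, hi i]); last first.
  apply/seteqP; split => w /=; rewrite in_itv /=; first exact.
  by move=> h _.
by have := ml measurableT _ (measurable_itv `[lo i, hi i]); rewrite setTI.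
Qed.

End event.

Theorem theorem10 (R : realType) :
  exists C : R, 0 < C /\
  forall (n d : nat) (disp : measure_display) (T : measurableType disp)
    (P : probability T R) (x : 'I_n -> {RV P >-> d.-tuple R}) (K : R),
  (n <= d)%N ->
  mutually_independent P (fun i => x i : T -> d.-tuple R) ->
  identically_distributed x ->
  covmx x \in unitmx ->
  (forall (i : 'I_n) (j : 'I_d), 'E_P[fun w => tnth (x i w) j] = 0)%E ->
  mutually_independent P
    (fun (ij : 'I_n * 'I_d) (w : T) => whitened x ij.1 w ij.2 0) ->
  (forall (i : 'I_n) (j : 'I_d),
     let z := fun w : T => whitened x i w j 0 in
     [/\ sub_gaussian P z, variance P z = 1%E & (psi2_norm P z <= K%:E)%E]) ->
  forall t : R, 0 <= t ->
  let eps := Num.sqrt (n%:R / d%:R) + t / Num.sqrt d%:R in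
  let delta := C * K ^+ 2 * Num.max eps (eps ^+ 2) in
  (P [set w | forall i : nat, (1 <= i <= n)%N ->
       (lambda (i + d - n)%N (covmx x) * (1 - delta)
          <= n%:R / d%:R * lambda i (sample_cov x w)
          <= lambda i (covmx x) * (1 + delta))%R]
   >= (1 - 2 * expR (- t ^+ 2))%:E)%E.
Proof.
exists (24 ^+ 3 * expR 1); split.
  by apply: mulr_gt0; [apply: exprn_gt0; rewrite ltr0n|exact: expR_gt0].
move=> n d disp T P x K nd _ _ unit_cov mean_x indz sub_z t t0; cbv zeta.
set eps := Num.sqrt (n%:R / d%:R) + t / Num.sqrt d%:R.
set delta := 24 ^+ 3 * expR 1 * K ^+ 2 * Num.max eps (eps ^+ 2).
have mEv := measurable_lambda_event x
  (fun i => lambda (i + d - n) (covmx x) * (1 - delta))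
  (fun i => lambda i (covmx x) * (1 + delta)) (n%:R / d%:R) nd.
set Ev := (X in P X); rewrite -/Ev in mEv.
(* For n = 0 the event is the whole space. Otherwise n, d > 0, and the existence of an entry yields
   both K > 0 and the square root of the covariance. *)
have [n0|n0] := posnP n.
  have -> : Ev = setT.
    apply/seteqP; split => // w _ i i1n.
    by exfalso; move: i1n; rewrite n0; case: i.
  rewrite [leRHS]probability_setT lee_fin; have := expR_ge0 (- t ^+ 2); lra.
have d0 : (0 < d)%N by exact: leq_trans nd.
pose z (ij : 'I_n * 'I_d) w := whitened x ij.1 w ij.2 0.
have mz ij : measurable_fun setT (z ij) by exact: measurable_whitened.
have mean_z ij : (\int[P]_w (z ij w)%:E = 0)%E.
  by apply: whitened_mean0 => i j; have := mean_x i j; rewrite unlock.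
have var_z ij : (\int[P]_w (z ij w ^+ 2)%:E = 1)%E.
  by apply: second_moment => //; have [] := sub_z ij.1 ij.2.
have psi_z ij : (psi2_norm P (z ij) <= K%:E)%E by have [] := sub_z ij.1 ij.2.
pose ij0 : 'I_n * 'I_d := (Ordinal n0, Ordinal d0).
have K0 : 0 < K := psi2_bound_gt0 (mz ij0) (var_z ij0) (psi_z ij0).
have [psdS SS unitS] : [/\ psdmx (sqrtmx (covmx x)),
    sqrtmx (covmx x) *m sqrtmx (covmx x) = covmx x &
    sqrtmx (covmx x) \in unitmx].
  by have [_ v1 _] := sub_z ij0.1 ij0.2; exact: covmx_sqrt v1 unit_cov.
have symS := proj1 psdS.
have [a0 delta0 la bound] := tail_exponent n0 d0 K0 t0.
rewrite -/eps -/delta in delta0 la bound.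
set a := (4 * expR 1 * K ^+ 2)^-1 in a0 la bound.
set l := a / 64 * Num.min 1 eps in la bound.
have sub ij : (\int[P]_w (expR (a * z ij w ^+ 2))%:E <= 2%:E)%E.
  exact: subgaussian_of_psi2.
have intz ij : P.-integrable setT (EFin \o z ij).
  exact: integrable_of_mean0.
(* Half of the target d delta, since passing from the net to all vectors doubles the bound. *)
set u := d%:R * delta / 2.
have [] := dev_union a0 mz indz intz mean_z var_z sub u la.
set bad := [set w | _] => mbad Pbad.
(* The deterministic half: outside [bad] the form of Z Z^T - d I is at most d delta / 2 on the net,
   hence at most d delta |v|^2 everywhere, and the eigenvalue bounds follow for all indices at
   once. *)
have good : ~` bad `<=` Ev.
  move=> w /= nbad i i1n; rewrite -SS /sample_cov (rowsmx_whitened w unitS symS).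
  apply: lambda_gram_sandwich => // v.
  pose Z := whitened_mx x w.
  have quadE' y : quad (Z *m Z^T - d%:R%:M) y =
      rdot (y *m Z) (y *m Z) - d%:R * rdot y y.
    by rewrite -quad_mulmx !quadE mulmxBr rdotBl mul_mx_scalar rdotZl.
  have devE y : dev z y w = quad (Z *m Z^T - d%:R%:M) y.
    rewrite quadE' /dev sumrB sumr_const card_ord mulr_natl (rdot_sqr (y *m Z)).
    congr (_ - _); apply: eq_bigr => j _; congr (_ ^+ 2).
    by rewrite mxE; apply: eq_bigr => i' _; rewrite mxE.
  rewrite -quadE'.
  apply: (@quad_le_net _ _ _ [set y | exists2 f, f \in net n & y = net_point R f]).
  - by rewrite linearB /= trmx_mul trmxK tr_scalar_mx.
  - by move=> _ [f fn ->]; exact: net_le1.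
  - move=> y /net_approx[f fn yf]; exists (net_point R f) => //; by exists f.
  - move=> _ [f fn ->]; rewrite -devE leNgt; apply/negP => lt_u.
    by apply: nbad; exists f; rewrite fn ltW.
have {}Pbad : (P bad <= (2 * expR (- t ^+ 2))%:E)%E.
  by apply: (le_trans Pbad); rewrite lee_fin.
apply: (@le_trans _ _ (P (~` bad))).
  by rewrite probability_setC// EFinB leeB.
by apply: le_measure => //; rewrite inE//; exact: measurableC.
Qed.
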